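(* Assume $V\in L^1_{loc}(\Omega)$ is balanced in $\Omega$ and $-\Delta+V$ is an $L^1$-subcritical operator in $\Omega$. Given $f\in L^1_{loc}(\Omega)$, an element $u\in\mathcal H_V(\Omega)$ is an energy solution to $-\Delta u+Vu=f$ if and only if $\mathbf J(u)$ is a distributional solution of $-\Delta u+Vu=f$ in $\Omega$.
   Context: $\Omega$ is a domain (nonempty connected open set) in $\mathbb R^N$, $N\ge1$. $W^{1,\infty}_c(\Omega)$: Lipschitz functions with compact support in $\Omega$; $Q_V(\xi)=\int_\Omega\{|\nabla\xi|^2+V\xi^2\}\,dx$; $Q_V\succeq0$ in $\Omega$ means $Q_V(\xi)\ge0$ for all $\xi\in W^{1,\infty}_c(\Omega)$; then $(\xi,\phi)\mapsto\int_\Omega\{\nabla\xi\cdot\nabla\phi+V\xi\phi\}$ is an inner product on $W^{1,\infty}_c(\Omega)$ with norm $\sqrt{Q_V}$. $\mathcal L_V(\Omega)=(W^{1,\infty}_c(\Omega),\sqrt{Q_V})$; $\mathcal H_V(\Omega)$ is its Hilbert space completion, with inner product $a_{V,\Omega}$. $-\Delta+V$ is $L^1$-subcritical in $\Omega$ if $Q_V\succeq0$ and $\mathcal L_V(\Omega)\hookrightarrow L^1_{loc}(\Omega)$ continuously; in this case $\mathbf J:\mathcal H_V(\Omega)\to L^1_{loc}(\Omega)$ denotes the unique continuous linear extension of the inclusion. Energy solution of $-\Delta u+Vu=f$: $u\in\mathcal H_V(\Omega)$ with $a_{V,\Omega}(u,\xi)=\int_\Omega f\xi$ for all $\xi\in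 W^{1,\infty}_c(\Omega)$. Distributional solution: $v\in L^1_{loc}(\Omega)$ with $Vv\in L^1_{loc}(\Omega)$ and $\int_\Omega v(-\Delta\xi+V\xi)=\int_\Omega f\xi$ for all $\xi\in C^\infty_c(\Omega)$. Balanced potentials. For a nonempty open $U\Subset\Omega$ (i.e. $\overline U$ a compact subset of $\Omega$) let $\mathcal B_V(\Omega;U)$ be the completion of $\mathcal L_V(\Omega;U)=(W^{1,\infty}_c(\Omega),\|\cdot\|^U_{V,\Omega})$, $\|\xi\|^U_{V,\Omega}=\sqrt{Q_V(\xi)}+\int_U|\xi|$, and let $\mathbf J_U:\mathcal B_V(\Omega;U)\to L^1(U)$ be the continuous extension of $\xi\mapsto\xi|_U$. For a closed ball $B\subset\Omega$ let $X_B$ be the completion of $C^2_c(B)$ ($C^2$ functions with compact support in the interior of $B$) in the $C^2(B)$ norm and $X_B^*$ its dual, with $L^1(B)$ viewed in $X_B^*$ through $g\mapsto(\varphi\mapsto\int_Bg\varphi)$. If $B\subset U$, the map $\xi\mapsto V\xi$ is continuous from $\mathcal L_V(\Omega;U)$ to $X_B^*$; let $\mathbb V_{B,U}:\mathcal B_V(\Omega;U)\to X_B^*$ be its continuous extension. $V\in L^1_{loc}(\Omega)$ is balanced in $\Omega$ if $Q_V\succeq0$ in $\Omega$ and for every closed ball $B\subset\Omega$ there is an open $U\Subset\Omega$ containing $B$ such that, for all $u\in\mathcal B_V(\Omega;U)$, $V\mathbf J_U(u)\in L^1(B)$ and $\mathbb V_{B,U}(u)=V\mathbf J_U(u)$ in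 $X_B^*$. *)

(* Defs.v *)
From HB Require Import structures.
From mathcomp Require Import all_boot all_order all_algebra.
From mathcomp Require Import all_classical all_reals all_analysis.

Set Implicit Arguments.
Unset Strict Implicit.
Unset Printing Implicit Defensive.

Import Order.TTheory GRing.Theory Num.Theory.
Import numFieldNormedType.Exports.

Local Open Scope classical_set_scope.
Local Open Scope ring_scope.

(* Row vectors carry the product (= Borel) sigma-algebra, as [n.-tuple T] does
   in the library. *)
Section measurable_row.
Context {R : realType} (n : nat).

Let coor (i : 'I_n) (x : 'rV[R]_n) : measurableTypeR R := x 0 i.

Let row_set0 : g_sigma_preimage coor set0.
Proof. exact: sigma_algebra0. Qed.

Let row_setC A : g_sigma_preimage coor A -> g_sigma_preimage coor (~` A).
Proof. exact: sigma_algebraC. Qed.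

Let row_bigcup (F : _^nat) : (forall i, g_sigma_preimage coor (F i)) ->
  g_sigma_preimage coor (\bigcup_i (F i)).
Proof. exact: sigma_algebra_bigcup. Qed.

HB.instance Definition _ := @isMeasurable.Build default_measure_display
  'rV[R]_n (g_sigma_preimage coor) row_set0 row_setC row_bigcup.

Lemma measurable_row_coor (i : 'I_n) :
  measurable_fun setT (fun x : 'rV[R]_n => x 0 i : measurableTypeR R).
Proof.
move=> _ Y mY; rewrite setTI; apply: sub_sigma_algebra.
by rewrite -bigcup_seq/=; exists i;
  [rewrite /= mem_index_enum | exists Y => //; rewrite setTI].
Qed.

Lemma measurable_fun_row d (T : measurableType d) (f : T -> 'rV[R]_n) :
  (forall i, measurable_fun setT (fun t => f t 0 i : measurableTypeR R)) ->
  measurable_fun setT f.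
Proof.
move=> mf _ A; rewrite setTI => mA.
pose G : set (set 'rV[R]_n) := [set B | measurable (f @^-1` B)].
suff : G A by [].
apply: mA; split.
- split; first by rewrite /G/= preimage_set0.
  + by move=> B GB; rewrite /G/= setTD -preimage_setC; exact: measurableC.
  + by move=> F GF; rewrite /G/= preimage_bigcup; exact: bigcupT_measurable.
- rewrite -bigcup_seq => B [i _ [C mC <-]]; rewrite /G/= setTI.
  by rewrite -[X in measurable X]setTI; exact: mf.
Qed.

End measurable_row.

Section lebesgue_row.
Context {R : realType}.

Definition row_snoc n (p : 'rV[R]_n * measurableTypeR R) : 'rV[R]_n.+1 :=
  \row_(i < n.+1) if unlift ord_max i is Some j then p.1 0 j else p.2.

Lemma measurable_row_snoc n : measurable_fun setT (@row_snoc n).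
Proof.
apply: measurable_fun_row => i; under eq_fun do rewrite mxE.
case: unliftP => [j _|_]; last exact: measurable_snd.
exact: (measurableT_comp (measurable_row_coor j)) measurable_fst.
Qed.

(* The Lebesgue measure of R^n, as an iterated product of one-dimensional
   Lebesgue measures. *)
Fixpoint lebesgue_row n : {measure set 'rV[R]_n -> \bar R} :=
  if n is n'.+1 then
    measure_function_pushforward__canonical__measure_function_Measure
      (lebesgue_row n' \x @lebesgue_measure R)%E (@measurable_row_snoc n')
  else \d_(0 : 'rV[R]_0).

Lemma measurable_box n (A : 'I_n -> set (measurableTypeR R)) :
  (forall i, measurable (A i)) ->
  measurable [set x : 'rV[R]_n | forall i, A i (x 0 i)].
Proof.
move=> mA.
rewrite (_ : [set x | _] =
    \bigcap_(i : 'I_n) ((fun x : 'rV[R]_n => x 0 i) @^-1` A i)); last first.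
  apply/seteqP; split => x /= Ax i; first by move=> _; exact: Ax.
  exact: (Ax i Logic.I).
apply: fin_bigcap_measurable => [|i _]; first exact: finite_finset.
by rewrite -[X in measurable X]setTI; exact: (measurable_row_coor i).
Qed.

Lemma lebesgue_row_box n (A : 'I_n -> set (measurableTypeR R)) :
  (forall i, measurable (A i)) ->
  lebesgue_row n [set x : 'rV[R]_n | forall i, A i (x 0 i)] =
  (\prod_(i < n) lebesgue_measure (A i))%E.
Proof.
elim: n A => [|n IH] A mA /=.
  by rewrite big_ord0 diracE mem_set// => -[].
rewrite /pushforward big_ord_recr/=.
rewrite -IH; last by move=> i; exact: mA.
set B := [set x : 'rV[R]_n | _].
have mB : measurable B.
  by apply: (@measurable_box _ (fun i => A (widen_ord (leqnSn n) i))) => i;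
    exact: mA.
rewrite -(@product_measure1E _ _ _ _ _ (lebesgue_row n) (@lebesgue_measure R)
  B (A ord_max) mB (mA ord_max)).
congr ((_ \x _)%E _); apply/seteqP; split => -[x t] /=.
  move=> h; split=> [i|].
    have := h (widen_ord (leqnSn n) i); rewrite mxE.
    have -> : widen_ord (leqnSn n) i = lift ord_max i.
      by apply/val_inj; rewrite /= /bump leqNgt ltn_ord.
    by rewrite liftK.
  by have := h ord_max; rewrite mxE unlift_none.
move=> [hx ht] i; rewrite mxE; case: unliftP => [j ->|-> //].
have := hx j; congr (A _ _); apply/val_inj.
by rewrite /= /bump leqNgt ltn_ord.
Qed.

End lebesgue_row.

Section sobolev.
Context {R : realType} {N : nat}.
Local Notation E := 'rV[R]_N.
Implicit Types (f g : E -> R) (A B K U Omega : set E).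

Definition pderiv (i : 'I_N) f : E -> R := 'D_(delta_mx 0 i) f.

(* For a Lipschitz function the partial derivatives exist almost everywhere;
   ['D_v f x] has a default value where the limit does not exist, which no
   integral below sees. *)
Definition dot_grad f g : E -> R := fun x => \sum_i pderiv i f x * pderiv i g x.

Definition laplacian f : E -> R := fun x => \sum_i pderiv i (pderiv i f) x.

Fixpoint isCk k f : Prop :=
  if k is k'.+1 then
    continuous f /\ forall i, (forall x, derivable f x (delta_mx 0 i)) /\
                              isCk k' (pderiv i f)
  else continuous f.

Definition smooth f := forall k, isCk k f.

Definition tsupport f : set E := closure [set x | f x != 0].

Definition compact_support_in A f := compact (tsupport f) /\ tsupport f `<=` A.

(* Euclidean balls: the library norm on ['rV[R]_N] is the sup norm. *)
Definition euclidean_closed_ball (c : E) (r : R) : set E :=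
  [set x | \sum_i (x 0 i - c 0 i) ^+ 2 <= r ^+ 2].

Definition compactly_contained U Omega :=
  compact (closure U) /\ closure U `<=` Omega.

Definition domain Omega := [/\ open Omega, connected Omega & Omega !=set0].

Definition L1 A f := (lebesgue_row N).-integrable A (EFin \o f).

(* Elements of L^1_loc are represented by Borel functions on R^N, of which only
   the values on Omega matter. *)
Definition L1loc Omega f :=
  measurable_fun Omega f /\
  forall K, compact K -> K `<=` Omega -> L1 K f.

Lemma tsupportD f g : tsupport (f + g) `<=` tsupport f `|` tsupport g.
Proof.
rewrite /tsupport -closureU; apply: closureS => x /=.
rewrite -[(f + g) x]/(f x + g x); have [->|] := eqVneq (f x) 0; last by left.
by rewrite add0r; right.
Qed.

Lemma tsupportZ (a : R) f : tsupport (a *: f) `<=` tsupport f.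
Proof.
apply: closureS => x /=; apply: contraNN => /eqP f0.
by rewrite -[(a *: f) x]/(a * f x) f0 mulr0.
Qed.

Lemma tsupport0 : tsupport 0 = set0.
Proof.
rewrite /tsupport (_ : [set x | _] = set0) ?closure0//.
by apply/seteqP; split => x //=; rewrite eqxx.
Qed.

Lemma compact_support_in0 A : compact_support_in A 0.
Proof. by rewrite /compact_support_in tsupport0; split => //; exact: compact0. Qed.

Lemma compact_support_inDZ A (a : R) f g :
  compact_support_in A f -> compact_support_in A g ->
  compact_support_in A (a *: f + g).
Proof.
move=> [cf fA] [cg gA].
have sub : tsupport (a *: f + g) `<=` tsupport f `|` tsupport g.
  by move=> x /tsupportD[/tsupportZ|]; [left|right].
split; last by move=> x /sub[/fA|/gA].
by apply: subclosed_compact (compactU cf cg) sub; exact: closed_closure.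
Qed.

Lemma lipschitzDZ (a : R) f g :
  lipschitz f -> lipschitz g -> lipschitz (a *: f + g).
Proof.
move=> /pinfty_ex_gt0[k k0 fk] /pinfty_ex_gt0[l l0 gl].
apply: (@klipschitzW _ _ _ (`|a| * k + l)).
  exact: (@globally_properfilter _ _ (0, 0)).
move=> -[x y] /= xy.
rewrite -[(a *: f + g) x]/(a * f x + g x) -[(a *: f + g) y]/(a * f y + g y).
rewrite opprD addrACA -mulrBr (le_trans (ler_normD _ _))// mulrDl lerD//.
  by rewrite normrM -mulrA ler_wpM2l//; exact: (fk (x, y) xy).
exact: (gl (x, y) xy).
Qed.

Lemma isCkDZ k (a : R) f g : isCk k f -> isCk k g -> isCk k (a *: f + g).
Proof.
have cDZ u v : continuous u -> continuous v -> continuous (a *: u + v : E -> R).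
  by move=> cu cv x; apply: cvgD (cv x); apply: cvgZl_tmp; exact: cu.
elim: k f g => [|k IH] f g /=; first exact: cDZ.
move=> [cf df] [cg dg]; split; first exact: cDZ.
move=> i; have [{}df Cf] := df i; have [{}dg Cg] := dg i.
split=> [x|]; first by apply: derivableD => //; exact: derivableZ.
rewrite (_ : pderiv i _ = a *: pderiv i f + pderiv i g); first exact: IH.
by apply/funext => x; rewrite /pderiv deriveD ?deriveZ//; exact: derivableZ.
Qed.

Lemma isCk0 k : isCk k 0.
Proof.
elim: k => [|k IH] /=; first exact: cst_continuous.
split=> [|i]; first exact: cst_continuous.
split=> [x|]; first exact: derivable_cst.
by rewrite (_ : pderiv i 0 = 0)//; apply/funext => x; exact: derive_cst.
Qed.

Definition Lip_c Omega : {pred (E -> R)} :=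
  fun xi => `[< lipschitz xi /\ compact_support_in Omega xi >].

Definition C2_c B : {pred (E -> R)} :=
  fun phi => `[< isCk 2 phi /\ compact_support_in B° phi >].

Lemma Lip_c_submod Omega : submod_closed (Lip_c Omega).
Proof.
split.
  apply/asboolP; split; last exact: compact_support_in0.
  apply: (@klipschitzW _ _ _ 0).
    exact: (@globally_properfilter _ _ (0, 0)).
  by move=> -[x y] _ /=; rewrite subrr normr0 mul0r.
move=> a f g /asboolP[fl fc] /asboolP[gl gc]; apply/asboolP.
by split; [exact: lipschitzDZ|exact: compact_support_inDZ].
Qed.

Lemma C2_c_submod B : submod_closed (C2_c B).
Proof.
split; first by apply/asboolP; split; [exact: isCk0|exact: compact_support_in0].
move=> a f g /asboolP[fl fc] /asboolP[gl gc]; apply/asboolP.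
by split; [exact: isCkDZ|exact: compact_support_inDZ].
Qed.

HB.instance Definition _ Omega :=
  GRing.isSubmodClosed.Build R (E -> R) (Lip_c Omega) (Lip_c_submod Omega).

HB.instance Definition _ B :=
  GRing.isSubmodClosed.Build R (E -> R) (C2_c B) (C2_c_submod B).

(* [W1oo_c Omega] : functions on R^N, i.e. functions on Omega extended by 0 *)
Record W1oo_c Omega := MkW1oo_c { W1oo_fun :> E -> R; _ : W1oo_fun \in Lip_c Omega }.
HB.instance Definition _ Omega := [isSub for @W1oo_fun Omega].
HB.instance Definition _ Omega := [Choice of W1oo_c Omega by <:].
HB.instance Definition _ Omega :=
  [SubChoice_isSubLmodule of W1oo_c Omega by <:].

Record C2c B := MkC2c { C2c_fun :> E -> R; _ : C2c_fun \in C2_c B }.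
HB.instance Definition _ B := [isSub for @C2c_fun B].
HB.instance Definition _ B := [Choice of C2c B by <:].
HB.instance Definition _ B := [SubChoice_isSubLmodule of C2c B by <:].

Definition C2_norm B f : R :=
  sup [set `|f x| | x in B] +
  \sum_i sup [set `|pderiv i f x| | x in B] +
  \sum_i \sum_j sup [set `|pderiv j (pderiv i f) x| | x in B].

End sobolev.

(* A completion of the seminormed space (W, p), up to isometry. *)
Record completion (R : realType) (W : lmodType R) (p : W -> R) := Completion {
  completion_space :> completeNormedModType R;
  completion_incl : {linear W -> completion_space};
  completion_norm : forall w, `|completion_incl w| = p w;
  completion_dense : dense (range completion_incl) }.

(* The Hilbert space completion of (W, q), up to isometry. *)
Record hilbert_completion (R : realType) (W : lmodType R) (q : W -> W -> R) :=
  HilbertCompletion {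
  hilbert_space :> completeNormedModType R;
  hilbert_ip : hilbert_space -> hilbert_space -> R;
  hilbert_incl : {linear W -> hilbert_space};
  hilbert_ipC : forall u v, hilbert_ip u v = hilbert_ip v u;
  hilbert_ip_linear : forall a u v w,
    hilbert_ip (a *: u + v) w = a * hilbert_ip u w + hilbert_ip v w;
  hilbert_normE : forall u, `|u| ^+ 2 = hilbert_ip u u;
  hilbert_incl_ip : forall v w,
    hilbert_ip (hilbert_incl v) (hilbert_incl w) = q v w;
  hilbert_dense : dense (range hilbert_incl) }.

(* The topological dual *)
Record dual (R : realType) (X : normedModType R) := Dual {
  dual_fun :> {linear X -> R^o};
  dual_continuous : continuous dual_fun }.

(* Maps T from a normed space X into L^1_loc(Omega) or L^1(U), given by
   representatives [T u : 'rV[R]_N -> R]. *)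
Section maps_to_L1.
Context {R : realType} {N : nat} {X : normedModType R}.
Local Notation E := 'rV[R]_N.
Implicit Types (T : X -> E -> R) (A Omega U : set E).

Definition ae_linear A T := forall a u v,
  T (a *: u + v) = a *: T u + T v %[ae lebesgue_row N in A].

Definition L1_continuous A T := forall u,
  \int[lebesgue_row N]_(x in A) `|T v x - T u x| @[v --> u] --> (0 : R).

(* [iota] identifies each w in W with an element of X *)
Definition ae_extends A (W : Type) (iota : W -> X) (F : W -> E -> R) T :=
  forall w, T (iota w) = F w %[ae lebesgue_row N in A].

Definition L1loc_extension Omega (W : Type) (iota : W -> X) (F : W -> E -> R) T :=
  [/\ forall u, L1loc Omega (T u),
      ae_linear Omega T,
      forall K, compact K -> K `<=` Omega -> L1_continuous K T
    & ae_extends Omega iota F T].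

Definition L1_extension U (W : Type) (iota : W -> X) (F : W -> E -> R) T :=
  [/\ forall u, L1 U (T u), ae_linear U T, L1_continuous U T
    & ae_extends U iota F T].

End maps_to_L1.

Section schroedinger.
Context {R : realType} {N : nat}.
Local Notation E := 'rV[R]_N.
Local Notation leb := (lebesgue_row N).
Implicit Types (Omega U B : set E) (V f v : E -> R).

Definition energy_form Omega V (xi phi : W1oo_c Omega) : R :=
  \int[leb]_(x in Omega) (dot_grad xi phi x + V x * xi x * phi x).

Definition energy Omega V (xi : W1oo_c Omega) : R := energy_form V xi xi.

Definition energy_nonneg Omega V := forall xi : W1oo_c Omega, 0 <= energy V xi.

Definition energy_norm Omega V (xi : W1oo_c Omega) : R := Num.sqrt (energy V xi).

(* The second clause is the continuity of the inclusion of W1oo_c Omega,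
   seminormed by [energy_norm V], into L^1_loc(Omega). *)
Definition L1_subcritical Omega V :=
  energy_nonneg Omega V /\
  forall K : set E, compact K -> K `<=` Omega ->
  forall (xi0 : W1oo_c Omega) (e : R), 0 < e -> exists2 d : R, 0 < d &
    forall xi : W1oo_c Omega, energy_norm V (xi - xi0) < d ->
      \int[leb]_(x in K) `|xi x - xi0 x| < e.

Definition energy_L1_norm Omega V U (xi : W1oo_c Omega) : R :=
  energy_norm V xi + \int[leb]_(x in U) `|xi x|.

(* [VV] is a continuous linear map into the dual of X (with its operator norm)
   that sends (the image of) each xi to V xi, as an element of this dual:
   phi |-> \int_B V xi phi. *)
Definition dual_extension Omega V B (Y X : normedModType R)
    (iota : W1oo_c Omega -> Y) (kappa : C2c B -> X) (VV : Y -> dual X) :=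
  [/\ forall a (u v : Y) phi, VV (a *: u + v) phi = a * VV u phi + VV v phi,
      forall (u : Y) (e : R), 0 < e -> \forall v \near u, forall phi,
        `|VV v phi - VV u phi| <= e * `|phi|
    & forall xi phi, VV (iota xi) (kappa phi) =
        \int[leb]_(x in B) (V x * xi x * phi x)].

(* Equality in X_B^* of L and g in L^1(B); it is enough to test on the dense
   subspace C^2_c(B) of X_B, where g acts by phi |-> \int_B g phi. *)
Definition dual_eq_L1 B (X : normedModType R) (kappa : C2c B -> X) (L : dual X)
    (g : E -> R) :=
  forall phi : C2c B, L (kappa phi) = \int[leb]_(x in B) (g x * phi x).

(* The completions and the continuous extensions J_U and VV exist and are
   unique, so that they may as well be quantified existentially. *)
Definition balanced_on Omega V B U :=
  exists (BV : completion (@energy_L1_norm Omega V U))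
         (XB : completion (fun phi : C2c B => C2_norm B phi))
         (JU : BV -> E -> R) (VV : BV -> dual XB),
  [/\ L1_extension U (@completion_incl _ _ _ BV) (@W1oo_fun R N Omega) JU,
      dual_extension V (@completion_incl _ _ _ BV) (@completion_incl _ _ _ XB) VV
    & forall u : BV, L1 B (V \* JU u) /\
        dual_eq_L1 (@completion_incl _ _ _ XB) (VV u) (V \* JU u)].

Definition balanced Omega V :=
  energy_nonneg Omega V /\
  forall (c : E) (r : R), 0 < r -> euclidean_closed_ball c r `<=` Omega ->
  exists U, [/\ open U, compactly_contained U Omega,
    euclidean_closed_ball c r `<=` U
  & balanced_on Omega V (euclidean_closed_ball c r) U].

Definition energy_solution Omega V f (H : hilbert_completion (@energy_form Omega V))
    (u : H) :=
  forall xi : W1oo_c Omega,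
    hilbert_ip u (hilbert_incl H xi) = \int[leb]_(x in Omega) (f x * xi x).

Definition distributional_solution Omega V f v :=
  [/\ L1loc Omega v, L1loc Omega (V \* v)
    & forall xi : E -> R, smooth xi -> compact_support_in Omega xi ->
      \int[leb]_(x in Omega) (v x * (- laplacian xi x + V x * xi x)) =
      \int[leb]_(x in Omega) (f x * xi x)].

End schroedinger.

(* Main.v *)
Require Import Defs.
From HB Require Import structures.
From mathcomp Require Import all_boot all_order all_algebra.
From mathcomp Require Import all_classical all_reals all_analysis.
From mathcomp Require Import ring lra measurable_realfun.

Set Implicit Arguments.
Unset Strict Implicit.
Unset Printing Implicit Defensive.

Import Order.TTheory GRing.Theory Num.Theory.
Import numFieldNormedType.Exports.

Local Open Scope classical_set_scope.
Local Open Scope ring_scope.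

(* Let [u] be an element of H_V(Omega), the limit of Lipschitz functions [xi_k].
   For a smooth test function [phi], integrating by parts,
   [a(xi_k, phi) = int (- xi_k laplacian phi + V xi_k phi)], where the first
   part converges by L^1-subcriticality.  On a small ball [B], balancedness and
   the convergence of [xi_k] in [B_V(Omega; U)] give the convergence of [V xi_k]
   to [V J(u)] in the dual of [C^2_c(B)]; cutting [phi] into pieces supported in
   such balls gives [a(u, phi) = int J(u) (- laplacian phi + V phi)], whence the
   direct implication.  Conversely, mollifications [zeta_k] of a Lipschitz
   function [xi] converge to it uniformly, with bounded Lipschitz constants, so
   that their gradients converge weakly; since the energies are bounded,
   [a(u, zeta_k)] tends to [a(u, xi)] for every [u], and the equation for the
   [zeta_k] passes to the limit.

   Integration by parts requires a Lipschitz function to be derivable along each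
   axis almost everywhere.  On a line, this follows from Radon-Nikodym and the
   Lebesgue differentiation theorem; Tonelli's theorem and translation
   invariance then treat all the lines parallel to the axis at once. *)

(** * Lebesgue measure on row vectors *)

(** As V is only in L^1_loc, convergence of [xi_k] in L^1_loc says nothing about the products V
    xi_k. In the dual of C^2_c(B) they converge because the energy norm controls them, but the limit
    is at first an abstract functional; balancedness is what identifies it with V J(u). One sequence
    serves for all balls: by L^1-subcriticality, a sequence that is Cauchy for the energy norm is
    also Cauchy in B_V(Omega; U), whatever U is, and its limits in the two completions have the same
    image in L^1(U).

    The resulting formula for a(u, phi) with phi smooth holds for every u and does not involve the
    equation, so the two notions of solution differ only by their test functions. The passage from
    smooth to Lipschitz test functions is a weak convergence in H_V(Omega): boundedness reduces it
    to pairings with Lipschitz functions, where the form is an explicit integral.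

    Partial derivatives here are pointwise limits with a default value, not distributions. This is
    why integration by parts rests on almost everywhere derivability, and why the set of
    derivability must be shown to be measurable. *)

Section row_borel.
Context {R : realType} {n : nat}.
Local Notation E := 'rV[R]_n.
Implicit Types (A K : set E) (f : E -> R).

Lemma measurable_row_ball (x : E) (e : R) : measurable (ball x e).
Proof.
(* A ball of radius at most 0 is empty, whereas for n = 0 the box below is the whole space. *)
have [e0|e0] := ltP 0 e; last first.
  rewrite (_ : ball x e = set0)//; apply/seteqP; split => // y [] /=.
  by rewrite ltNge e0.
rewrite (_ : ball x e = [set y : E | forall i, ball (x 0 i) e (y 0 i)]).
  by apply: (measurable_box (A := fun i => ball (x 0 i) e)) => i; exact: measurable_ball.
apply/seteqP; split => [y [_ xy] i|y xy]; first exact: xy.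
by split=> // i j; rewrite ord1; exact: xy.
Qed.

(** The sigma-algebra is generated by the coordinates, so second countability is needed: an open set
    is the union of the countably many balls with rational centre and radius 1/(k+1) that it
    contains. *)
Lemma open_measurable_row A : open A -> measurable A.
Proof.
move=> oA.
pose D (p : 'rV[rat]_n * nat) : set E :=
  ball (\row_j ratr (p.1 0 j) : E) p.2.+1%:R^-1.
pose F p := if pselect (D p `<=` A) then D p else set0.
rewrite (_ : A = \bigcup_p F p); last first.
  apply/seteqP; split => x; last first.
    by move=> [p _]; rewrite /F; case: pselect => // pA; exact: pA.
  move=> /oA/nbhs_ballP[e /= e0 xeA].
  have [k ke] : exists k : nat, k.+1%:R^-1 < e / 2.
    have e20 : 0 < e / 2 by rewrite divr_gt0.
    near \oo => k; exists k.
    by near: k; exact: near_infty_natSinv_lt (PosNum e20).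
  have k0 : 0 < k.+1%:R^-1 :> R by rewrite invr_gt0.
  have /choice[q xq] : forall j, exists q : rat, `|x 0 j - ratr q| < k.+1%:R^-1.
    move=> j; have : x 0 j - k.+1%:R^-1 < x 0 j + k.+1%:R^-1.
      by rewrite ltrD2l gtrN.
    move=> /rat_in_itvoo[q]; rewrite in_itv/= => /andP[q1 q2].
    by exists q; rewrite distrC ltr_distl q1 q2.
  have Dx y : D (\row_j q j, k) y = forall j, `|ratr (q j) - y 0 j| < k.+1%:R^-1.
    apply/propext; split => [[_ h] j|h].
      by have := h 0 j; rewrite /ball/= !mxE.
    by split => // i j; rewrite /ball/= ord1 !mxE.
  exists (\row_j q j, k) => //; rewrite /F; case: pselect => [DA|] /=.
    by rewrite Dx => j; rewrite distrC.
  case=> y; rewrite Dx => h; apply: xeA; split => // i j.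
  rewrite ord1 /ball/= -(subrKA (ratr (q j))).
  rewrite (le_lt_trans (ler_normD _ _))//.
  by rewrite [ltRHS](splitr e) ltrD// (lt_trans _ ke).
apply: countable_bigcupT_measurable; first exact: countableP.
move=> p; rewrite /F; case: pselect => //= DA; exact: measurable_row_ball.
Unshelve. all: by end_near. Qed.

Lemma closed_measurable_row A : closed A -> measurable A.
Proof.
by move=> /closed_openC/open_measurable_row/measurableC; rewrite setCK.
Qed.

Lemma row_hausdorff : hausdorff_space E.
Proof. exact: norm_hausdorff. Qed.

Lemma compact_measurable_row A : compact A -> measurable A.
Proof. by move=> /(compact_closed row_hausdorff)/closed_measurable_row. Qed.

Lemma continuous_measurable_row f : continuous f -> measurable_fun setT f.
Proof.
move=> cf; apply: (measurability _ (RGenOpens.measurableE R)) => //.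
move=> _ [_ [a [b ->] <-]]; rewrite setTI; apply: open_measurable_row.
by apply: open_comp => // x _; exact: cf.
Qed.

Lemma measurable_fun_translate (a : E) : measurable_fun setT (fun x : E => x + a).
Proof.
apply: measurable_fun_row => i; under eq_fun do rewrite mxE.
by apply: measurable_funD => //; exact: measurable_row_coor.
Qed.

End row_borel.

(** * Sigma-finiteness, Tonelli's theorem and translation invariance *)

Section row_measure.
Context {R : realType}.
Local Notation leb := (@lebesgue_row R).

Lemma lebesgue_row_ball_fin n (x : 'rV[R]_n) (e : R) :
  exists M : R, leb n (ball x e) = M%:E.
Proof.
have [e0|e0] := ltP 0 e; last first.
  exists 0; rewrite (_ : ball x e = set0) ?measure0//.
  by apply/seteqP; split => // y [] /=; rewrite ltNge e0.
exists (\prod_(i < n) (e *+ 2)).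
rewrite (_ : ball x e = [set y : 'rV[R]_n | forall i, ball (x 0 i) e (y 0 i)]).
  rewrite (lebesgue_row_box (A := fun i => ball (x 0 i) e)); last first.
    by move=> i; exact: measurable_ball.
  rewrite -prodEFin; apply: eq_bigr => i _.
  by rewrite lebesgue_measure_ball// ltW.
apply/seteqP; split => [y [_ xy] i|y xy]; first exact: xy.
by split=> // i j; rewrite ord1; exact: xy.
Qed.

(** A second name for the same measure, on which the sigma-finite structure required by Tonelli's
    theorem can be declared. *)
Definition sigma_lebesgue_row n : set 'rV[R]_n -> \bar R := leb n.

HB.instance Definition _ n := Measure.on (@sigma_lebesgue_row n).

Let sigma_finite_lebesgue_row n : sigma_finite setT (@sigma_lebesgue_row n).
Proof.
exists (fun k => ball (0 : 'rV[R]_n) k.+1%:R).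
  apply/seteqP; split => // x _.
  have := archi_boundP (normr_ge0 x); set k := Num.bound _ => xk.
  exists k => //; rewrite -ball_normE/= sub0r normrN (lt_le_trans xk)//.
  by rewrite ler_nat.
move=> k; split; first exact: measurable_row_ball.
by have [M ME] := lebesgue_row_ball_fin (0 : 'rV[R]_n) k.+1%:R;
  rewrite /sigma_lebesgue_row ME ltry.
Qed.

HB.instance Definition _ n := @Measure_isSigmaFinite.Build _ _ _
  (@sigma_lebesgue_row n) (@sigma_finite_lebesgue_row n).

Local Open Scope ereal_scope.

Lemma ge0_integral_lebesgue_rowS n (f : 'rV[R]_n.+1 -> \bar R) :
  measurable_fun setT f -> (forall x, 0 <= f x) ->
  \int[leb n.+1]_x f x =
  \int[leb n]_x \int[lebesgue_measure]_t f (row_snoc (x, t)).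
Proof.
move=> mf f0.
rewrite [LHS](@ge0_integral_pushforward _ _ _ _ _ _ (@measurable_row_snoc R n)
  (leb n \x @lebesgue_measure R)%E setT f)//.
rewrite preimage_setT.
apply: (@fubini_tonelli1 _ _ _ _ R (@sigma_lebesgue_row n) (@lebesgue_measure R)
  (f \o @row_snoc R n)) => [|x]; last exact: f0.
exact: measurableT_comp (@measurable_row_snoc R n).
Qed.

(** The image of Lebesgue measure under a translation gives half-open intervals their length, hence
    is Lebesgue measure by uniqueness. *)
Lemma ge0_integral_lebesgue_translate (s : R) (f : measurableTypeR R -> \bar R) :
  measurable_fun setT f -> (forall x, 0 <= f x) ->
  \int[lebesgue_measure]_t f (t + s)%R = \int[lebesgue_measure]_t f t.
Proof.
move=> mf f0.
have mD : measurable_fun setT (fun t : measurableTypeR R => (t + s)%R : measurableTypeR R).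
  exact: measurable_funD.
have pE A : measurable A ->
    lebesgue_measure A = pushforward (@lebesgue_measure R)
       (fun t : measurableTypeR R => (t + s)%R : measurableTypeR R) A.
  apply: lebesgue_measure_unique => X [[a b] _ <-].
  transitivity (lebesgue_measure `](a - s)%R, (b - s)%R]%classic); last first.
    congr lebesgue_measure; apply/seteqP.
    by split => x /=; rewrite !in_itv/= ltrBlDr lerBrDr.
  rewrite !lebesgue_measure_itv/= !lte_fin ltrD2r//.
  by case: ifPn => // _; rewrite -!EFinD opprB addrA subrK.
transitivity (\int[pushforward (@lebesgue_measure R)
   (fun t : measurableTypeR R => (t + s)%R : measurableTypeR R)]_t f t).
  by rewrite ge0_integral_pushforward//=.
by apply: eq_measure_integral => A mA _; exact/esym/pE.
Qed.

(** Induction on n: the inner integral absorbs the last coordinate of [a], and the induction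
    hypothesis, applied to the partial integral [F], absorbs the others. *)
Lemma ge0_integral_row_translate n (a : 'rV[R]_n) (f : 'rV[R]_n -> \bar R) :
  measurable_fun setT f -> (forall x, 0 <= f x) ->
  \int[leb n]_x f (x + a)%R = \int[leb n]_x f x.
Proof.
elim: n a f => [|n IH] a f mf f0.
  by apply: eq_integral => x _; congr (f _); apply/rowP => -[].
rewrite ge0_integral_lebesgue_rowS//; last first.
  exact: measurableT_comp (measurable_fun_translate a).
rewrite ge0_integral_lebesgue_rowS//.
pose a' : 'rV[R]_n := (\row_j a ord0 (lift ord_max j))%R.
pose F x := \int[lebesgue_measure]_t f (row_snoc (x, t)).
have mF : measurable_fun setT F.
  apply: (@measurable_fun_fubini_tonelli_F _ _ _ _ R (@lebesgue_measure R)
    (f \o @row_snoc R n)) => [|x]; last exact: f0.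
  exact: measurableT_comp (@measurable_row_snoc R n).
rewrite -[RHS](IH a' F)//; last by move=> x; apply: integral_ge0 => *; exact: f0.
apply: eq_integral => x _; rewrite /F.
rewrite -[RHS](ge0_integral_lebesgue_translate (a ord0 ord_max))//.
  apply: eq_integral => t _; congr f; apply/rowP => j.
  by rewrite !mxE; case: unliftP => [k ->|->] //=; rewrite !mxE.
apply: measurableT_comp => //.
by apply: measurableT_comp; [exact: measurable_row_snoc|exact: pair1_measurable].
Qed.

End row_measure.

(** * Translations of integrals, and sets that are null along parallel lines *)

Section row_translation.
Context {R : realType} {n : nat}.
Local Notation E := 'rV[R]_n.
Local Notation leb := (lebesgue_row n).
Implicit Types (f : E -> R) (a v : E) (S : set E).

Lemma integral_row_translate a (f : E -> \bar R) : measurable_fun setT f ->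
  (\int[leb]_x f (x + a)%R = \int[leb]_x f x)%E.
Proof.
move=> mf; rewrite [LHS]integralE [RHS]integralE; congr (_ - _)%E.
  rewrite -(ge0_integral_row_translate a (measurable_funepos mf) (funepos_ge0 f)).
  by apply: eq_integral => x _; rewrite !funeposE.
rewrite -(ge0_integral_row_translate a (measurable_funeneg mf) (funeneg_ge0 f)).
by apply: eq_integral => x _; rewrite !funenegE.
Qed.

Lemma L1_measurable A f : L1 A f -> measurable_fun A f.
Proof. by move=> /measurable_int/measurable_EFinP. Qed.

Lemma L1_translate a f : L1 setT f -> L1 setT (fun x => f (x + a)).
Proof.
move=> lf; have mf := L1_measurable lf; apply/integrableP; split.
  by apply/measurable_EFinP/measurableT_comp => //; exact: measurable_fun_translate.
move/integrableP : lf => [_]; rewrite -(ge0_integral_row_translate a)//.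
by do 2 apply: measurableT_comp => //.
Qed.

Lemma Rintegral_row_translate a f : measurable_fun setT f ->
  \int[leb]_x f (x + a) = \int[leb]_x f x.
Proof.
move=> mf; congr fine.
by apply: (integral_row_translate a (f := EFin \o f)); exact/measurable_EFinP.
Qed.

Lemma lebesgue_row_translate a S : measurable S ->
  leb [set x | S (x + a)] = leb S.
Proof.
move=> mS.
have mSa : measurable [set x | S (x + a)].
  by rewrite -[X in measurable X]setTI; exact: measurable_fun_translate.
have indE A : measurable A -> leb A = (\int[leb]_x (\1_A x)%:E)%E.
  by move=> mA; rewrite integral_indic// setIT.
rewrite !indE// -[RHS](integral_row_translate a)//.
exact/measurable_EFinP.
Qed.

(** Integrate the indicator of the pairs (x, t) with x + t v in S. Integrating in t first gives 0 by
    hypothesis; integrating in x first gives the measure of S for each t, by translation invariance.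
    The direction v is thus arbitrary and no change of coordinates occurs. *)
Lemma lebesgue_row_line_null v S : measurable S ->
  (forall x, lebesgue_measure.-negligible [set t : R | S (x + t *: v)]) ->
  leb S = 0.
Proof.
move=> mS S0.
pose phi (p : E * measurableTypeR R) : E := p.1 + (p.2 : R) *: v.
have mphi : measurable_fun setT phi.
  apply: measurable_fun_row => i; under eq_fun do rewrite !mxE.
  apply: measurable_funD.
    exact: measurableT_comp (measurable_row_coor i) measurable_fst.
  by apply: measurable_funM => //; exact: measurable_snd.
(* As [0, 1] has measure 1, the second iterated integral is exactly the measure of S. *)
pose W : set (E * measurableTypeR R) := phi @^-1` S `&` snd @^-1` `[0, 1]%classic.
have mW : measurable W.
  apply: measurableI; rewrite -[X in measurable X]setTI; first exact: mphi.
  exact: measurable_snd.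
have mI : measurable_fun setT (EFin \o \1_W : _ -> \bar R).
  exact/measurable_EFinP.
have := @fubini_tonelli _ _ _ _ R (@sigma_lebesgue_row R n) (@lebesgue_measure R)
  (EFin \o \1_W) mI (fun x => _).
rewrite (_ : (fun x => _) = cst 0%E); last first.
  apply/funext => x.
  have mWx : measurable ([set t : measurableTypeR R | W (x, t)]).
    by rewrite -[X in measurable X]setTI; exact: (pair1_measurable x).
  transitivity (\int[lebesgue_measure]_t (\1_[set t : measurableTypeR R | W (x, t)] t)%:E)%E.
    by apply: eq_integral => t _; rewrite /= !indicE.
  rewrite integral_indic// setIT; apply/(negligibleP _ mWx).
  by apply: negligibleS (S0 x) => t [].
rewrite integral0.
rewrite (_ : (fun x => _) = (fun t : measurableTypeR R =>
   (leb S * (\1_(`[0%R, 1%R]%classic : set (measurableTypeR R)) t)%:E)%E));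
   last first.
  apply/funext => t; rewrite indicE.
  have mWt : measurable [set x : E | W (x, t)].
    by rewrite -[X in measurable X]setTI; exact: (pair2_measurable t).
  transitivity (leb [set x : E | W (x, t)]).
    transitivity (\int[leb]_x (\1_[set x : E | W (x, t)] x)%:E)%E; last first.
      by rewrite integral_indic// setIT.
    by apply: eq_integral => x _; rewrite /= !indicE.
  have [t01|t01] := boolP (t \in _).
    rewrite mule1 -(lebesgue_row_translate (t *: v) mS); congr (leb _).
    by apply/seteqP; split => x /=; [case|split => //; exact/set_mem].
  rewrite mule0 (_ : [set x | _] = set0) ?measure0//.
  by apply/seteqP; split => x // -[_ /= h]; move: t01; rewrite mem_set.
rewrite ge0_integralZl//; last 1 first.
  exact/measurable_EFinP.
have -> : (\int[lebesgue_measure]_t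
    (\1_(`[0%R, 1%R]%classic : set (measurableTypeR R)) t)%:E = 1)%E.
  transitivity (lebesgue_measure (`[0%R, 1%R]%classic : set R)); last first.
    by rewrite lebesgue_measure_itv/= lte_fin ltr01 sube0.
  by rewrite integral_indic//= setIT.
rewrite mule1.
by move/(_ _)/esym; apply => x; rewrite lee_fin.
Qed.

End row_translation.

(** * Almost everywhere derivability of Lipschitz functions *)

Section lipschitz_ae_derivable.
Context {R : realType}.
Local Notation mu := (@lebesgue_measure R).

Lemma lebesgue_stieltjes_oc (F : cumulative R R) (a b : R) : a <= b ->
  lebesgue_stieltjes_measure F `]a, b]%classic = (F b - F a)%:E.
Proof.
move=> ab; rewrite /lebesgue_stieltjes_measure/=.
rewrite /measure_extension measurable_mu_extE/=; last exact: is_ocitv.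
by rewrite wlength_itv_bnd.
Qed.

(** The measure (dF + dG)/c agrees with Lebesgue measure on half-open intervals, hence everywhere,
    and a set null for a sum of measures is null for each of them. *)
Lemma lebesgue_stieltjes_dominates (F G : cumulative R R) (c : R) : 0 < c ->
  (forall x, F x + G x = c * x) -> lebesgue_stieltjes_measure F `<< mu.
Proof.
move=> c0 FG; apply/null_content_dominatesP => A mA A0.
have ci0 : 0 <= c^-1 by rewrite invr_ge0 ltW.
pose nu := mscale (NngNum ci0) (measure_add (lebesgue_stieltjes_measure F)
  (lebesgue_stieltjes_measure G)).
have nuE X : nu X = (c^-1%:E * (lebesgue_stieltjes_measure F X +
    lebesgue_stieltjes_measure G X))%E.
  by congr (_ * _)%E; exact: measure_addE.
have muI X : ocitv X -> mu X = nu X.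
  move=> [[a b] _ <-]; rewrite nuE.
  have [/= ab|/= ba] := leP a b; last first.
    by rewrite set_itv_ge ?measure0 ?adde0 ?mule0// bnd_simp -leNgt ltW.
  rewrite !lebesgue_stieltjes_oc//.
  rewrite lebesgue_measure_itv/= lte_fin.
  have -> : (F b - F a)%:E + (G b - G a)%:E = (c * (b - a))%:E :> \bar R.
    by rewrite -EFinD mulrBr -!FG; congr _%:E; ring.
  rewrite -EFinM mulrA mulVf ?gt_eqF// mul1r EFinB.
  by case: ltgtP ab => // -> _; rewrite -EFinB subrr.
have := lebesgue_measure_unique (mu := nu) muI mA; 
  rewrite [X in _ = X -> _]nuE [X in X = _ -> _]A0 => /esym/eqP.
rewrite mule_eq0 eqe invr_eq0 gt_eqF//= padde_eq0//.
by move=> /andP[/eqP].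
Qed.

(** Restricted to ]-M, M], dF is a finite measure and has a Radon-Nikodym density g. So F differs by
    a constant from the integral of g on ]-M, M[, and the Lebesgue differentiation theorem
    applies. *)
Lemma dominated_cumulative_ae_derivable (F : cumulative R R) (M : R) :
  continuous F ->
  lebesgue_stieltjes_measure F `<< mu ->
  {ae mu, forall x, - M < x < M -> derivable F x 1}.
Proof.
move=> cF dom.
have [M0|M0] := leP M 0.
  apply: aeW => x /andP[+ xM]; rewrite ltNge => /negP[].
  by rewrite (le_trans (ltW xM))// (le_trans M0)// oppr_ge0.
have MM : - M <= M by lra.
pose D : set (measurableTypeR R) := `]- M, M]%classic.
have mD : measurable D by exact: measurable_itv.
have Dfin : (lebesgue_stieltjes_measure F D < +oo)%E.
  by rewrite /D lebesgue_stieltjes_oc// ltry.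
pose nu : {finite_measure set _ -> \bar R} := mfrestr mD Dfin.
have nudom : nu `<< mu.
  apply/null_content_dominatesP => A mA A0.
  move/null_content_dominatesP : dom; apply; first exact: measurableI.
  by apply/eqP; rewrite -measure_le0 -A0 le_measure// ?inE//; exact: measurableI.
have [g [g0 gfin gint nuE]] := radon_nikodym_sigma_finite nudom.
have gEfin : EFin \o (fine \o g) = g by apply/funext => x /=; rewrite fineK.
have gint' A : measurable A -> mu.-integrable A (EFin \o (fine \o g)).
  by move=> mA; rewrite gEfin; exact: integrableS gint.
pose G x := (\int[mu]_(t in [set` Interval (BRight (- M)) (BRight x)]) (fine \o g) t)%R.
have FE x : - M < x < M -> F x = G x + F (- M).
  move=> /andP[Mx xM]; apply/eqP; rewrite -subr_eq; apply/eqP.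
  apply: EFin_inj; rewrite -lebesgue_stieltjes_oc ?ltW//.
  transitivity (nu `]- M, x]%classic).
    rewrite /nu/= /mfrestr/= /mrestr/=; congr lebesgue_stieltjes_measure.
    apply/esym/setIidl => y/=; rewrite /D/= !in_itv/= => /andP[-> yx]/=.
    by rewrite (le_trans yx)// ltW.
  rewrite nuE//.
  rewrite /G /Rintegral -/(EFin \o (fine \o g)) gEfin fineK//.
  by apply: integrable_fin_num => //; exact: integrableS gint.
have locg : locally_integrable setT (fine \o g).
  by apply: open_integrable_locally; [exact: openT|exact: gint'].
have := FTC1 (fun y => gint' _ (measurable_itv (Interval (BRight (- M)) (BRight y)))) locg.
apply: filterS; first exact: (ae_filter_ringOfSetsType mu).
move=> x /= h /andP[Mx xM].
have [|dG _] := h; first by rewrite lte_fin.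
apply: (@near_eq_derivable _ _ _ (G + cst (F (- M)))); last first.
  by apply: derivableD => //; exact: derivable_cst.
near=> y; rewrite [RHS]FE//; apply/andP; split; near: y.
- exact: (cvgr_gt x).
- exact: (cvgr_lt x).
Unshelve. all: by end_near. Qed.

(** Both L x + f(x) and L x - f(x) are nondecreasing and their sum is 2 L x, so the Stieltjes
    measure of the first is dominated by Lebesgue measure. Its derivability is that of f. *)
Lemma lipschitz_ae_derivable (f : R -> R) (L : R) :
  (forall x y, `|f x - f y| <= L * `|x - y|) ->
  {ae mu, forall x, derivable f x 1}.
Proof.
move=> fL0.
wlog L0 : L fL0 / 0 < L.
  move=> /(_ (`|L| + 1)); apply.
    move=> x y; rewrite (le_trans (fL0 x y))// ler_wpM2r//.
    by rewrite (le_trans (ler_norm _))// lerDl.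
  by rewrite ltr_wpDl.
have cf : continuous f.
  move=> x; apply/cvgrPdist_lt => e e0; near=> y.
  rewrite (le_lt_trans (fL0 _ _))// -ltr_pdivlMl//.
  near: y; exists (L^-1 * e) => //=.
  by rewrite mulr_gt0 ?invr_gt0.
pose F s x := L * x + s * f x.
have cF s : continuous (F s).
  by move=> x; apply: cvgD; apply: cvgM => //; [exact: cvg_cst|exact: cvg_cst|exact: cf].
have ndF s : `|s| = 1 -> nondecreasing (F s).
  move=> s1 x y xy; rewrite /F -subr_ge0.
  have := fL0 x y; rewrite (ler0_norm (x := x - y)) ?subr_le0//.
  have : `|s * (f x - f y)| = `|f x - f y| by rewrite normrM s1 mul1r.
  move=> <-; rewrite ler_norml => /andP[h1 h2]; lra.
have N1 : `|- 1| = 1 :> R by rewrite normrN1.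
pose F1 : cumulative R R := HB.pack (F 1)
  (isCumulative.Build _ _ _ (F 1) (ndF 1 (normr1 _)) (right_continuousW (cF 1))).
pose F2 : cumulative R R := HB.pack (F (-1))
  (isCumulative.Build _ _ _ (F (-1)) (ndF (-1) N1) (right_continuousW (cF (-1)))).
have dom : lebesgue_stieltjes_measure F1 `<< mu.
  apply: (@lebesgue_stieltjes_dominates F1 F2 (2 * L)); first by rewrite mulr_gt0.
  by move=> x; rewrite /= /F; ring.
have h k : {ae mu, forall x, - k%:R < x < k%:R -> derivable F1 x 1}.
  exact: (@dominated_cumulative_ae_derivable F1 k%:R (cF 1) dom).
have /ae_foralln := h.
apply: filterS => x hx.
have -> : f = (fun x => F1 x - L * x) by apply/funext => y; rewrite /= /F; ring.
apply: derivableB => //; apply: (hx (Num.bound `|x|)).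
by rewrite -ltr_norml; exact: archi_boundP.
Unshelve. all: by end_near. Qed.
End lipschitz_ae_derivable.

(** * Lipschitz functions and difference quotients *)

Section lipschitz_row.
Context {R : realType} {n : nat}.
Local Notation E := 'rV[R]_n.
Local Notation e_ i := (delta_mx 0 i : E).
Implicit Types (f g : E -> R) (L : R).

(** Unlike [lipschitz], it displays the constant, which must be uniform along sequences of
    functions. *)
Definition Lip L f := forall x y : E, `|f x - f y| <= L * `|x - y|.

Lemma lipschitzP f : lipschitz f -> exists2 L, 0 < L & Lip L f.
Proof.
move=> /pinfty_ex_gt0[L L0 fL]; exists L => // x y.
exact: (fL (x, y) (conj Logic.I Logic.I)).
Qed.

Lemma Lip_lipschitz L f : Lip L f -> lipschitz f.
Proof.
move=> fL; apply: (@klipschitzW _ _ _ L).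
  exact: (@globally_properfilter _ _ (0, 0)).
by move=> -[x y] _ /=; exact: fL.
Qed.

Lemma Lip_continuous L f : Lip L f -> continuous f.
Proof.
move=> fL x; apply/(@cvgrPdist_lt _ _ _ (nbhs x)) => e e0.
have L0 : 0 < `|L| + 1 by rewrite ltr_wpDl.
apply/nbhs_ballP; exists ((`|L| + 1)^-1 * e) => /=.
  by rewrite mulr_gt0 ?invr_gt0.
move=> y; rewrite -ball_normE /= => xy.
rewrite (le_lt_trans (fL _ _))// (@le_lt_trans _ _ ((`|L| + 1) * `|x - y|))//.
  by rewrite ler_wpM2r// (le_trans (ler_norm _))// lerDl.
by rewrite -ltr_pdivlMl.
Qed.

Lemma norm_delta_le1 (i : 'I_n) : `|e_ i| <= 1.
Proof.
rewrite /Num.norm/= mx_normrE; apply/bigmax_leP; split => // -[a b] _ /=.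
by rewrite mxE ord1 eqxx/=; case: eqP => _ /=; rewrite ?normr1 ?normr0.
Qed.

(** The order of the summands makes it convertible to the quotient in the definitions of [derivable]
    and ['D_v]. *)
Definition dquot (v : E) f (h : R) : E -> R := fun x => h^-1 * (f (h *: v + x) - f x).

Lemma dquot_measurable v f h : continuous f -> measurable_fun setT (dquot v f h).
Proof.
move=> cf; apply: measurable_funM => //; apply: measurable_funB; last first.
  exact: continuous_measurable_row.
apply: (@measurableT_comp _ _ _ _ _ _ f); first exact: continuous_measurable_row.
rewrite (_ : +%R (h *: v) = fun x => x + h *: v); last first.
  by apply/funext => x; rewrite addrC.
exact: measurable_fun_translate.
Qed.

Lemma derivableE f x v : derivable f x v = cvg (dquot v f h x @[h --> 0^']).
Proof. by []. Qed.

Lemma deriveE f x v : 'D_v f x = lim (dquot v f h x @[h --> 0^']).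
Proof. by []. Qed.

Lemma dquot_le L v f h x : 0 <= L -> Lip L f -> `|dquot v f h x| <= L * `|v|.
Proof.
move=> L0 fL; rewrite /dquot normrM normfV.
have [->|h0] := eqVneq h 0; first by rewrite normr0 invr0 mul0r mulr_ge0.
rewrite ler_pdivrMl ?normr_gt0// (le_trans (fL _ _))// addrK normrZ.
by rewrite mulrCA.
Qed.

Lemma dquot_continuous v f x h : continuous f -> h != 0 ->
  {for h, continuous (dquot v f ^~ x)}.
Proof.
move=> cf h0; apply: cvgM; first exact: cvgV.
apply: cvgB; last exact: cvg_cst.
apply: (@cvg_comp _ _ _ (fun h => h *: v + x) f _ (nbhs (h *: v + x)));
  last exact: cf.
by apply: cvgD; [exact: cvgZr_tmp|exact: cvg_cst].
Qed.

(** One instance of the Cauchy criterion at step 0; rational steps make it a countable intersection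
    of measurable conditions. *)
Definition dcauchy v f (k m : nat) : set E :=
  [set x | forall p q : rat, 0 < `|ratr p : R| < m.+1%:R^-1 ->
     0 < `|ratr q : R| < m.+1%:R^-1 ->
     `|dquot v f (ratr p) x - dquot v f (ratr q) x| <= k.+1%:R^-1].

Lemma measurable_dcauchy v f k m : continuous f -> measurable (dcauchy v f k m).
Proof.
move=> cf.
pose D (p : rat * rat) : set E :=
  if (0 < `|ratr p.1 : R| < m.+1%:R^-1) && (0 < `|ratr p.2 : R| < m.+1%:R^-1)
  then [set x | k.+1%:R^-1 < `|dquot v f (ratr p.1) x - dquot v f (ratr p.2) x|]
  else set0.
have -> : dcauchy v f k m = ~` (\bigcup_p D p).
  apply/seteqP; split => [x h [[p q] _]|x h p q p0 q0].
    by rewrite /D /=; case: ifPn => // /andP[p0 q0] /=; rewrite ltNge h.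
  rewrite leNgt; apply/negP => pq; apply: h; exists (p, q) => //.
  by rewrite /D/= p0 q0.
apply: measurableC; apply: countable_bigcupT_measurable; first exact: countableP.
move=> p; rewrite /D; case: ifPn => // _.
rewrite -[X in measurable X]setTI.
apply: measurable_fun_ltr => //.
by apply: measurableT_comp => //; apply: measurable_funB; exact: dquot_measurable.
Qed.

(** Rational steps suffice because, for continuous f, the quotient is continuous in the step away
    from 0. *)
Lemma derivable_dcauchy v f : continuous f ->
  [set x | derivable f x v] = \bigcap_k \bigcup_m dcauchy v f k m.
Proof.
move=> cf; apply/seteqP; split => x /=.
  rewrite derivableE => /cvg_ex[l /= fl] k _.
  have k0 : 0 < (k.+1%:R^-1 / 2 : R) by rewrite divr_gt0.
  move/cvgrPdist_le : fl => /(_ _ k0)[d /= d0 fd].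
  have [m _ /(_ _ (leqnn _)) md] := near_infty_natSinv_lt (PosNum d0).
  exists m => // p q /andP[p0 pm] /andP[q0 qm].
  rewrite -(subrKA l) (le_trans (ler_normD _ _))// [leRHS]splitr lerD//.
    rewrite distrC fd//=; last by rewrite -normr_gt0.
    by rewrite sub0r normrN (lt_trans pm).
  rewrite fd//=; last by rewrite -normr_gt0.
  by rewrite sub0r normrN (lt_trans qm).
move=> h; rewrite derivableE; apply/cauchy_cvgP/cauchy_exP => e e0.
(* Three errors below e/4 occur: one for replacing each of two real steps by a rational one, and one
   from the Cauchy criterion between the rational steps. *)
have e40 : 0 < e / 4 by rewrite divr_gt0.
have [k _ /(_ _ (leqnn _)) /= ke] := near_infty_natSinv_lt (PosNum e40).
have [m _ hm] := h k Logic.I.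
have m0 : 0 < m.+1%:R^-1 :> R by rewrite invr_gt0.
have rat_near t : 0 < `|t| < m.+1%:R^-1 -> exists p : rat,
    0 < `|ratr p : R| < m.+1%:R^-1 /\ `|dquot v f t x - dquot v f (ratr p) x| < e / 4.
  move=> /andP[t0 tm]; rewrite normr_gt0 in t0.
  have ct := dquot_continuous (v := v) (x := x) cf t0.
  have : \forall s \near t, [/\ s != 0, `|s| < m.+1%:R^-1 &
      `|dquot v f t x - dquot v f s x| < e / 4].
    near=> s; split; near: s.
    - exact: (cvgr_neq0 t).
    - by apply: (cvgr_lt `|t|) => //; apply: cvg_norm; exact: cvg_id.
    - by move/cvgrPdist_lt : ct; apply.
  move=> /nbhs_ballP[d /= d0 td].
  have : t - d < t + d by lra.
  move=> /rat_in_itvoo[p]; rewrite in_itv/= => pd; exists p.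
  have [p0 pm pe] : [/\ (ratr p : R) != 0, `|ratr p : R| < m.+1%:R^-1 &
      `|dquot v f t x - dquot v f (ratr p) x| < e / 4].
    by apply: td; rewrite -ball_normE /= distrC ltr_distl.
  by rewrite normr_gt0 p0.
pose t0 : R := m.+2%:R^-1.
have t0P : 0 < `|t0| < m.+1%:R^-1.
  by rewrite normr_gt0 invr_eq0 pnatr_eq0/= ger0_norm ?invr_ge0// ltf_pV2 ?posrE ?ltr_nat.
have [p [p0 pt]] := rat_near _ t0P.
exists (dquot v f t0 x); exists m.+1%:R^-1 => //= t /= tm tn0.
rewrite -ball_normE /=.
have [|q [q0 qt]] := rat_near t.
  by rewrite normr_gt0 tn0/= -normrN -sub0r.
have := hm p q p0 q0 => pq.
rewrite -(subrKA (dquot v f (ratr p) x)) (le_lt_trans (ler_normD _ _))//.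
rewrite -(subrKA (dquot v f (ratr q) x) (dquot v f (ratr p) x)).
have := ler_normD (dquot v f (ratr p) x - dquot v f (ratr q) x)
    (dquot v f (ratr q) x - dquot v f t x).
rewrite [`|dquot v f (ratr q) x - _|]distrC.
have := le_lt_trans pq ke.
move: pt qt e0; clear; lra.
Unshelve. all: by end_near. Qed.

End lipschitz_row.

(** * Dominated convergence and integration by parts for Lipschitz functions *)

Section lipschitz_calculus.
Context {R : realType} {n : nat}.
Local Notation E := 'rV[R]_n.
Local Notation leb := (lebesgue_row n).
Local Notation e_ i := (delta_mx 0 i : E).
Implicit Types (f g : E -> R) (L M C : R) (i : 'I_n).

(** Bounded support with an explicit radius, so that a whole sequence of functions can share one
    dominating function. *)
Definition bsupp M f := forall x : E, M <= `|x| -> f x = 0.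

Lemma measurable_derivable f (v : E) : continuous f ->
  measurable [set x | derivable f x v].
Proof.
move=> cf; rewrite derivable_dcauchy//; apply: bigcapT_measurable => k.
by apply: bigcupT_measurable => m; exact: measurable_dcauchy.
Qed.

(** On every line parallel to v the restriction of f is Lipschitz, so the measurable set of bad
    points is null along each of these lines. *)
Lemma Lip_ae_derivable L f (v : E) : Lip L f ->
  {ae leb, forall x, derivable f x v}.
Proof.
move=> fL; have cf := Lip_continuous fL.
have mD := measurableC (measurable_derivable v cf).
exists (~` [set x | derivable f x v]); split => //.
apply: (lebesgue_row_line_null (v := v)) => // x.
have gL s t : `|f (x + s *: v) - f (x + t *: v)| <= (L * `|v|) * `|s - t|.
  rewrite (le_trans (fL _ _))// opprD addrACA subrr add0r -scalerBl normrZ.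
  by rewrite (mulrC `|s - t|) mulrA.
have := lipschitz_ae_derivable gL; apply: negligibleS => t /=; apply: contra_not.
rewrite /derivable; set u := (X in cvg (X @ _) -> _); set w := (X in _ -> cvg (X @ _)).
suff -> : u = w by [].
apply/funext => h; rewrite /u /w /=; congr (_ *: (f _ - _)).
by rewrite -[h%:A]/(h * 1) mulr1 scalerDl addrCA.
Qed.

Lemma dquot_cvg f (v x : E) : derivable f x v ->
  dquot v f k.+1%:R^-1 x @[k --> \oo] --> 'D_v f x.
Proof.
move=> dfx; have /cvgr_dnbhsP : dquot v f h x @[h --> 0^'] --> 'D_v f x by exact: dfx.
apply; split; first by move=> k; rewrite invr_eq0 pnatr_eq0.
exact: cvg_harmonic.
Qed.

Lemma cvgn_le (u : nat -> R) (l M : R) : u k @[k --> \oo] --> l ->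
  (forall k, u k <= M) -> l <= M.
Proof.
move=> ul uM; rewrite -(cvg_lim (@Rhausdorff R) ul).
by apply: limr_le; [apply/cvg_ex; exists l|exact: nearW].
Qed.

Lemma derive_le L f (v x : E) : 0 <= L -> Lip L f -> `|'D_v f x| <= L * `|v|.
Proof.
move=> L0 fL; have [dfx|/dvgP dfx] := pselect (derivable f x v).
  by apply: (cvgn_le (cvg_norm (dquot_cvg dfx))) => k; exact: dquot_le.
(* At a point where f is not derivable, ['D_v f x] takes the default value 0. *)
by rewrite /derive dfx normr0 mulr_ge0.
Qed.

Lemma pderiv_le L f i x : 0 <= L -> Lip L f -> `|pderiv i f x| <= L.
Proof.
move=> L0 fL; rewrite (le_trans (derive_le _ _ L0 fL))//.
by rewrite ler_piMr// norm_delta_le1.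
Qed.

Lemma measurable_derive f (v : E) : continuous f -> measurable_fun setT ('D_v f).
Proof.
move=> cf; pose D := [set x | derivable f x v].
have mD : measurable D by exact: measurable_derivable.
rewrite -(setUv D); apply/measurable_funU => //; first exact: measurableC.
split.
  apply: (measurable_fun_cvg (h := fun k => dquot v f k.+1%:R^-1)) => [k|x].
    by apply: measurable_funTS; exact: dquot_measurable.
  exact: dquot_cvg.
have h : measurable_fun (~` D) (cst 0 : E -> R) by [].
apply: eq_measurable_fun h => x /set_mem/= /dvgP.
by rewrite /derive => ->.
Qed.

Lemma measurable_pderiv f i : continuous f -> measurable_fun setT (pderiv i f).
Proof. exact: measurable_derive. Qed.

Lemma L1D A f g : measurable A -> L1 A f -> L1 A g ->
  L1 A (fun x => f x + g x).
Proof. by move=> mA fi gi; have := integrableD mA fi gi. Qed.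

Lemma L1B A f g : measurable A -> L1 A f -> L1 A g ->
  L1 A (fun x => f x - g x).
Proof. by move=> mA fi gi; have := integrableB mA fi gi. Qed.

Lemma L1Z A c f : measurable A -> L1 A f -> L1 A (fun x => c * f x).
Proof. by move=> mA fi; have := integrableZl mA c fi. Qed.

Lemma L1S A B f : measurable A -> measurable B -> B `<=` A -> L1 A f -> L1 B f.
Proof. by move=> mA mB BA fi; exact: integrableS fi. Qed.

Lemma L1_abs A f : L1 A f -> L1 A (fun x => `|f x|).
Proof. by move=> fi; have := integrable_abse fi. Qed.

Lemma integrable_ball_cst C M :
  leb.-integrable setT (EFin \o (C \o* \1_(ball (0 : E) M))).
Proof.
have mB : measurable (ball (0 : E) M) by exact: measurable_row_ball.
rewrite (_ : EFin \o _ = fun x => (C%:E * (EFin \o \1_(ball (0 : E)%R M)) x)%E); last first.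
  by apply/funext => x /=; rewrite -EFinM mulrC.
apply: integrableZl => //; apply/integrableP; split; first exact/measurable_EFinP.
rewrite (eq_integral (EFin \o \1_(ball (0 : E) M))); last first.
  by move=> x _; rewrite /= ger0_norm.
rewrite integral_indic// setIT.
by have [K ->] := lebesgue_row_ball_fin (0 : E) M; exact: ltry.
Qed.

Lemma bsupp_bound C M f : (forall x, `|f x| <= C) -> bsupp M f ->
  forall x, `|f x| <= C * \1_(ball (0 : E) M) x.
Proof.
move=> fC fM x; rewrite indicE; have [xM|xM] := boolP (x \in _).
  by rewrite mulr1.
rewrite mulr0 fM ?normr0// leNgt; apply: contraNN xM => xM.
by rewrite inE -ball_normE /= sub0r normrN.
Qed.

Lemma L1_bounded C M f : measurable_fun setT f ->
  (forall x, `|f x| <= C) -> bsupp M f -> L1 setT f.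
Proof.
move=> mf fC fM.
apply: (le_integrable measurableT _ _ (integrable_ball_cst C M)).
  exact/measurable_EFinP.
move=> x _; rewrite lee_fin /= (le_trans (bsupp_bound fC fM x))//.
by rewrite mulrC ler_norm.
Qed.

Lemma Rintegral_dominated C M (fk : nat -> E -> R) f :
  (forall k, measurable_fun setT (fk k)) -> measurable_fun setT f ->
  (forall k x, `|fk k x| <= C) -> (forall k, bsupp M (fk k)) ->
  {ae leb, forall x, fk k x @[k --> \oo] --> f x} ->
  \int[leb]_x fk k x @[k --> \oo] --> \int[leb]_x f x /\
  \int[leb]_x `|fk k x - f x| @[k --> \oo] --> 0.
Proof.
move=> mfk mf fkC fkM fkf.
have [] := @dominated_convergence _ _ _ leb setT measurableT
  (fun k => EFin \o fk k) (EFin \o f) (EFin \o (C \o* \1_(ball (0 : E) M))).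
- by move=> k; exact/measurable_EFinP.
- exact/measurable_EFinP.
- by apply: filterS fkf => x fx _; apply: cvg_EFin => //; exact: nearW.
- exact: integrable_ball_cst.
- apply: aeW => x k _; rewrite lee_fin /= mulrC.
  exact: bsupp_bound.
move=> fi c0 c1; split; last exact: (fine_cvg c0).
apply: fine_cvg; rewrite fineK//; exact: integrable_fin_num.
Qed.

Lemma Rintegral_dquot0 M f (v : E) h : continuous f -> L1 setT f ->
  \int[leb]_x dquot v f h x = 0.
Proof.
move=> cf fi; have mf := continuous_measurable_row cf.
have fhi : L1 setT (fun x => f (h *: v + x)).
  by rewrite (_ : (fun x => _) = fun x => f (x + h *: v));
    [exact: L1_translate|apply/funext => x; rewrite addrC].
rewrite /dquot RintegralZl//; last exact: L1B.
rewrite RintegralB// -[X in _ * (_ - X)](Rintegral_row_translate (h *: v))//.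
under eq_Rintegral do rewrite addrC.
by rewrite subrr mulr0.
Qed.

(** The step vector has norm at most 1, so the support grows by at most 1. *)
Lemma bsupp_dquot M f i h : bsupp M f -> `|h| <= 1 ->
  bsupp (M + 1) (dquot (e_ i) f h).
Proof.
move=> fM h1 x Mx; rewrite /dquot !fM ?subrr ?mulr0//.
  by rewrite (le_trans _ Mx)// lerDl.
rewrite addrC (le_trans _ (lerB_normD _ _))// lerBrDr (le_trans _ Mx)// lerD2l.
by rewrite normrZ mulr_ile1// norm_delta_le1.
Qed.

Lemma bsupp_le M M' f : M <= M' -> bsupp M f -> bsupp M' f.
Proof. by move=> MM' fM x xM'; apply: fM; exact: le_trans xM'. Qed.

Lemma bsupp_derive M f i : bsupp M f -> bsupp (M + 1) (pderiv i f).
Proof.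
move=> fM x Mx.
have [dfx|/dvgP] := pselect (derivable f x (e_ i)); last first.
  by rewrite /pderiv /derive => ->.
have dq0 k : dquot (e_ i) f k.+1%:R^-1 x = 0.
  have k1 : `|k.+1%:R^-1 : R| <= 1 by rewrite ger0_norm// invf_le1// ler1n.
  exact: (bsupp_dquot i fM k1 Mx).
apply: (@cvg_unique _ (@Rhausdorff R) _ _ _ _ (dquot_cvg dfx)).
by apply: cvg_near_cst; apply: nearW => k; exact: dq0.
Qed.

Lemma Lip_bounded L M f : 0 <= L -> 0 <= M -> Lip L f -> bsupp M f ->
  forall x, `|f x| <= `|f 0| + L * M.
Proof.
move=> L0 M0 fL fM x; have [Mx|xM] := leP M `|x|.
  by rewrite fM// normr0 addr_ge0// mulr_ge0.
rewrite -lerBlDl (le_trans (lerB_dist _ _))// (le_trans (fL _ _))//.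
by rewrite subr0 ler_wpM2l// ltW.
Qed.

Lemma cvg_dquot_L1 L M f i : 0 <= L -> 0 <= M -> Lip L f -> bsupp M f ->
  \int[leb]_x dquot (e_ i) f k.+1%:R^-1 x @[k --> \oo] --> \int[leb]_x pderiv i f x /\
  \int[leb]_x `|dquot (e_ i) f k.+1%:R^-1 x - pderiv i f x| @[k --> \oo] --> 0.
Proof.
move=> L0 M0 fL fM; have cf := Lip_continuous fL.
apply: (@Rintegral_dominated L (M + 1)).
- by move=> k; exact: dquot_measurable.
- exact: measurable_pderiv.
- move=> k x; rewrite (le_trans (dquot_le _ _ _ L0 fL))//.
  by rewrite ler_piMr// norm_delta_le1.
- move=> k; apply: (bsupp_dquot i fM).
  by rewrite ger0_norm// invf_le1// ler1n.
- apply: filterS (Lip_ae_derivable (e_ i) fL) => x; exact: dquot_cvg.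
Qed.

Lemma Lip_L1 L M f : 0 <= L -> 0 <= M -> Lip L f -> bsupp M f -> L1 setT f.
Proof.
move=> L0 M0 fL fM; apply: L1_bounded (Lip_bounded L0 M0 fL fM) fM.
exact: continuous_measurable_row (Lip_continuous fL).
Qed.

(** Difference quotients have integral 0 by translation invariance, and they converge boundedly to
    the derivative almost everywhere, with supports in a fixed ball. *)
Lemma Rintegral_pderiv0 L M f i : 0 <= L -> 0 <= M -> Lip L f -> bsupp M f ->
  \int[leb]_x pderiv i f x = 0.
Proof.
move=> L0 M0 fL fM; have [h _] := cvg_dquot_L1 i L0 M0 fL fM.
apply: (@cvg_unique _ (@Rhausdorff R) _ _ _ _ h).
apply: cvg_near_cst; apply: nearW => k; apply: Rintegral_dquot0 => //.
  exact: Lip_continuous fL.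
exact: Lip_L1 fL fM.
Qed.

Lemma LipM L L' C C' f g : Lip L f -> Lip L' g -> 
  (forall x, `|f x| <= C) -> (forall x, `|g x| <= C') ->
  0 <= L -> 0 <= L' -> Lip (C * L' + C' * L) (f \* g).
Proof.
move=> fL gL fC gC L0 L'0 x y /=.
have -> : f x * g x - f y * g y = f x * (g x - g y) + g y * (f x - f y) by ring.
rewrite (le_trans (ler_normD _ _))// mulrDl !normrM -!mulrA.
by rewrite lerD// ler_pM.
Qed.

Lemma bsuppM M f g : bsupp M f -> bsupp M (f \* g).
Proof. by move=> fM x xM /=; rewrite fM// mul0r. Qed.

(** The product f g is again Lipschitz, so its derivative has integral 0; the Leibniz rule holds
    where both factors are derivable, that is, almost everywhere. *)
Lemma integration_by_parts_row L L' M f g i : 0 <= L -> 0 <= L' -> 0 <= M ->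
  Lip L f -> Lip L' g -> bsupp M f -> bsupp M g ->
  \int[leb]_x (f x * pderiv i g x) = - \int[leb]_x (g x * pderiv i f x).
Proof.
move=> L0 L'0 M0 fL gL fM gM.
have fC := Lip_bounded L0 M0 fL fM; have gC := Lip_bounded L'0 M0 gL gM.
have cf := Lip_continuous fL; have cg := Lip_continuous gL.
have mf := continuous_measurable_row cf; have mg := continuous_measurable_row cg.
have mdf := measurable_pderiv i cf; have mdg := measurable_pderiv i cg.
have fgi : L1 setT (fun x => f x * pderiv i g x).
  apply: (@L1_bounded ((`|f 0| + L * M) * L') M).
  - exact: measurable_funM.
  - by move=> x; rewrite normrM ler_pM// pderiv_le.
  - exact: bsuppM.
have gfi : L1 setT (fun x => g x * pderiv i f x).
  apply: (@L1_bounded ((`|g 0| + L' * M) * L) M).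
  - exact: measurable_funM.
  - by move=> x; rewrite normrM ler_pM// pderiv_le.
  - exact: bsuppM.
apply/eqP; rewrite -addr_eq0 -RintegralD//; apply/eqP.
have hL := LipM fL gL fC gC L0 L'0.
rewrite -(Rintegral_pderiv0 i _ M0 hL (bsuppM g fM)); last first.
  by rewrite addr_ge0// mulr_ge0// addr_ge0// mulr_ge0.
congr fine; apply: ae_eq_integral => //.
- by apply/measurable_EFinP; apply: measurable_funD; exact: measurable_funM.
- apply/measurable_EFinP; exact: measurable_pderiv (Lip_continuous hL).
apply: filterS2 (Lip_ae_derivable (e_ i) fL) (Lip_ae_derivable (e_ i) gL).
move=> x dfx dgx _ /=; congr EFin.
by rewrite [RHS](deriveM dfx dgx).
Qed.

End lipschitz_calculus.

(** * Mollification *)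

Section isCk_theory.
Context {R : realType} {n : nat}.
Local Notation E := 'rV[R]_n.
Local Notation e_ i := (delta_mx 0 i : E).
Implicit Types (f g : E -> R) (L M C : R) (i : 'I_n) (k : nat).

Lemma isCk_continuous k f : isCk k f -> continuous f.
Proof. by case: k => [|k] // -[]. Qed.

Lemma isCkS k f : isCk k.+1 f -> isCk k f.
Proof.
elim: k f => [|k IH] f [cf df] //; split => // i.
by have [{}df Cf] := df i; split => //; exact: IH.
Qed.

Lemma isCk_pderiv k f i : isCk k.+1 f -> isCk k (pderiv i f).
Proof. by move=> [_ /(_ i)[]]. Qed.

Lemma isCk_derivable k f i x : isCk k.+1 f -> derivable f x (e_ i).
Proof. by move=> [_ /(_ i)[]]. Qed.

Lemma isCkD k f g : isCk k f -> isCk k g -> isCk k (f + g).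
Proof. by move=> /isCkDZ h /h => /(_ 1); rewrite scale1r. Qed.

Lemma isCkZ k (a : R) f : isCk k f -> isCk k (a *: f).
Proof. by move=> /isCkDZ/(_ (@isCk0 R n k)) => /(_ a); rewrite addr0. Qed.

Lemma pderiv_cst (c : R) i : pderiv i (fun=> c) = 0 :> (E -> R).
Proof. by apply/funext => x; exact: derive_cst. Qed.

Lemma isCk_cst k (c : R) : isCk k (fun _ : E => c).
Proof.
case: k => [|k] /=; first exact: cst_continuous.
split; first exact: cst_continuous.
move=> i; split => [x|]; first exact: derivable_cst.
by rewrite pderiv_cst; exact: isCk0.
Qed.

Lemma isCkM k f g : isCk k f -> isCk k g -> isCk k (f \* g).
Proof.
have cM (u v : E -> R) : continuous u -> continuous v -> continuous (u \* v).
  by move=> cu cv x; exact: cvgM (cu x) (cv x).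
elim: k f g => [|k IH] f g /=; first exact: cM.
move=> Cf Cg; have [cf df] := Cf; have [cg dg] := Cg.
split; first exact: cM.
move=> i; have [{}df df'] := df i; have [{}dg dg'] := dg i.
split=> [x|]; first exact: derivableM.
rewrite (_ : pderiv i _ = f \* pderiv i g + g \* pderiv i f).
  by apply: isCkD; apply: IH => //; exact: isCkS.
by apply/funext => x; rewrite /pderiv; exact: deriveM.
Qed.

Lemma isCk_prod k (I : Type) (r : seq I) (F : I -> E -> R) :
  (forall j, isCk k (F j)) -> isCk k (fun x => \prod_(j <- r) F j x).
Proof.
move=> CF; elim: r => [|j r IH].
  by under eq_fun do rewrite big_nil; exact: isCk_cst.
by under eq_fun do rewrite big_cons; exact: isCkM.
Qed.

(** The function of one variable comes with the sequence [D] of its successive derivatives, so the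
    induction on k merely shifts j. *)
Lemma isCk_coord k (j : nat) i (D : nat -> R -> R) :
  (forall m (s : R), is_derive s (1 : R) (D m) (D m.+1 s)) ->
  isCk k (fun x : E => D j (x 0 i)).
Proof.
move=> dD.
have cD m : continuous (fun x : E => D m (x 0 i)).
  move=> x; apply: (@continuous_comp _ _ _ (fun x : E => x 0 i) (D m)).
    exact: coord_continuous.
  apply: differentiable_continuous; apply/derivable1_diffP.
  exact: ex_derive.
elim: k j => [|k IH] j /=; first exact: cD.
split; first exact: cD.
move=> l.
have qE x :
    (fun h : R => h^-1 *: (((fun x : E => D j (x 0 i)) \o shift x) (h *: e_ l) - D j (x 0 i)))
   = if l == i
      then (fun h : R => h^-1 *: ((D j \o shift (x 0 i)) (h *: 1) - D j (x 0 i)))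
      else cst 0.
  apply/funext => h /=; rewrite !mxE eqxx/= eq_sym; case: eqP => //= _.
  by rewrite mulr0 add0r subrr scaler0.
have dE x : derivable (fun x : E => D j (x 0 i)) x (e_ l).
  rewrite /derivable qE; case: ifPn => _; last exact: is_cvg_cst.
  exact: (@ex_derive _ _ _ _ _ _ _ (dD j (x 0 i))).
split=> //.
have -> : pderiv l (fun x : E => D j (x 0 i)) =
    if l == i then (fun x : E => D j.+1 (x 0 i)) else 0.
  apply/funext => x; rewrite /pderiv /derive qE; case: ifPn => _.
    exact: (@derive_val _ _ _ _ _ _ _ (dD j (x 0 i))).
  exact: lim_cst.
by case: ifPn => _ //; exact: isCk0.
Qed.

End isCk_theory.

(** * Compactly supported functions of class C^1 are Lipschitz *)

Section C1_lipschitz.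
Context {R : realType} {n : nat}.
Local Notation E := 'rV[R]_n.
Local Notation e_ i := (delta_mx 0 i : E).
Implicit Types (f g : E -> R) (L M C : R) (i : 'I_n) (k : nat).

Lemma norm_coord_le (x : E) i : `|x 0 i| <= `|x|.
Proof.
rewrite [leRHS]/Num.norm/= mx_normrE.
exact: (@le_bigmax _ _ _ _ (fun p => `|x p.1 p.2|) (0, i)).
Qed.

Lemma compact_closed_ball (c : E) M : compact [set x : E | `|x - c| <= M].
Proof.
apply: bounded_closed_compact.
  exists (M + `|c|); split; first exact: num_real.
  move=> K MK x /= xM; rewrite (le_trans _ (ltW MK))// -lerBlDr.
  by rewrite (le_trans (lerB_dist _ _)).
rewrite (_ : [set _ | _] = (fun x : E => `|x - c|) @^-1` [set t | t <= M])//.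
apply: preimage_closed; last exact: closed_le.
move=> x _; apply: (@Lip_continuous _ _ 1) => {}x y.
by rewrite mul1r (le_trans (ler_dist_dist _ _))// opprB addrA subrK.
Qed.

Lemma continuous_bounded f M : continuous f -> bsupp M f ->
  exists2 C, 0 <= C & forall x, `|f x| <= C.
Proof.
move=> cf fM.
have /compact_bounded[K [Kr hK]] : compact (f @` [set x : E | `|x - 0| <= M]).
  apply: continuous_compact; last exact: compact_closed_ball.
  exact: continuous_subspaceT.
exists (`|K| + 1); first by rewrite addr_ge0.
move=> x; have [Mx|xM] := leP M `|x|; first by rewrite fM// normr0 addr_ge0.
apply: hK; first by rewrite (le_lt_trans (ler_norm K))// ltrDl.
by exists x => //=; rewrite subr0 ltW.
Qed.

Lemma C1_line_lipschitz C f i (z : E) (s : R) : isCk 1 f ->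
  (forall x, `|pderiv i f x| <= C) ->
  `|f (z + s *: e_ i) - f z| <= C * `|s|.
Proof.
move=> Cf fC.
wlog s0 : z s / 0 <= s.
  move=> H; have [/H//|s0] := leP 0 s.
  have := H (z + s *: e_ i) (- s); rewrite oppr_ge0 ltW// => /(_ erefl).
  by rewrite scaleNr addrK distrC normrN.
pose g t := f (z + t *: e_ i).
have qE t : (fun h : R => h^-1 *: ((g \o shift t) (h *: 1) - g t)) =
    (fun h : R => h^-1 *: ((f \o shift (z + t *: e_ i)) (h *: e_ i) - f (z + t *: e_ i))).
  apply/funext => h /=; rewrite /g; congr (_ *: (f _ - _)).
  by rewrite -[h%:A]/(h * 1) mulr1 scalerDl addrCA.
have dg t : is_derive t (1 : R) g (pderiv i f (z + t *: e_ i)).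
  apply: DeriveDef; first by rewrite /derivable qE; exact: isCk_derivable Cf.
  by rewrite /pderiv /derive qE.
have cg : {within `[0, s], continuous g}.
  apply: continuous_subspaceT => t; apply: differentiable_continuous.
  by apply/derivable1_diffP; exact: ex_derive.
have [t _] := MVT_segment s0 (fun t _ => dg t) cg.
rewrite /g scale0r addr0 subr0 => ->.
by rewrite normrM ler_wpM2r.
Qed.

(** Go from y to x by changing one coordinate at a time: [z k] has the first k coordinates of x and
    the others of y. By the mean value theorem each of the n moves costs at most [C'] times the norm
    of x - y. *)
Lemma C1_Lip f M : isCk 1 f -> bsupp M f -> exists2 L, 0 <= L & Lip L f.
Proof.
move=> Cf fM.
have /choice[C hC] i : exists C, 0 <= C /\ forall x, `|pderiv i f x| <= C.
  have [|C C0 h] := @continuous_bounded (pderiv i f) (M + 1) _ (bsupp_derive i fM).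
    exact: isCk_continuous (isCk_pderiv i Cf).
  by exists C.
pose C' := \sum_i C i.
have C0 i : 0 <= C i by have [] := hC i.
have CC i : C i <= C'.
  by rewrite /C' (bigD1 i)//= lerDl sumr_ge0.
have C'0 : 0 <= C' by apply: sumr_ge0.
exists (n%:R * C'); first by rewrite mulr_ge0.
move=> x y; pose z k : E := \row_j if (j < k)%N then x 0 j else y 0 j.
have zn : z n = x by apply/rowP => j; rewrite mxE ltn_ord.
have z0 : z 0%N = y by apply/rowP => j; rewrite mxE.
rewrite -{1}zn; have := leqnn n.
elim: {1 3 4}n => [|k IH] kn; first by rewrite z0 subrr normr0 !mul0r.
have zS : z k.+1 = z k + (x 0 (Ordinal kn) - y 0 (Ordinal kn)) *: e_ (Ordinal kn).
  apply/rowP => j; rewrite !mxE eqxx/= ltnS leq_eqVlt.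
  have [->|jk] := eqVneq j (Ordinal kn).
    by rewrite /= eqxx ltnn/= mulr1 addrC subrK.
  rewrite mulr0 addr0; suff -> : (j == k :> nat) = false by [].
  by apply/negbTE; apply: contraNN jk => /eqP jk; apply/eqP/val_inj.
rewrite -(subrKA (f (z k))) (le_trans (ler_normD _ _))//.
rewrite -natr1 addrC mulrDl mulrDl lerD ?IH ?(ltnW kn)// mul1r zS.
have [_ h] := hC (Ordinal kn).
rewrite (le_trans (C1_line_lipschitz _ _ Cf h))// ler_pM//.
by have := norm_coord_le (x - y) (Ordinal kn); rewrite !mxE.
Qed.

End C1_lipschitz.

(** * The flat function exp(-1/x) and its derivatives *)

Section bump.
Context {R : realType}.
Implicit Types (P : {poly R}) (x s C : R).

(* For P = 1 this is the function exp (-1/x) extended by 0; the family over all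
   polynomials P is closed under differentiation. *)
Definition flat P x : R := if 0 < x then P.[x^-1] * expR (- x^-1) else 0.

(** From the chain rule: for x > 0, the derivative of P(1/x) exp(-1/x) is x^-2 (P - P')(1/x)
    exp(-1/x). *)
Definition flat_next P : {poly R} := 'X^2 * (P - P^`()).

Lemma pow_expRN_le m s : 0 < s -> s ^+ m * expR (- s) <= m`!%:R.
Proof.
move=> s0; rewrite expRN ler_pdivrMr ?expR_gt0//.
case: m => [|m].
  by rewrite mul1r expr0 (le_trans _ (expR_ge1Dx s))// lerDl ltW.
rewrite -ler_pdivrMl ?ltr0n ?fact_gt0// mulrC.
by rewrite (le_trans _ (expR_ge1Dxn m (ltW s0)))// lerDr.
Qed.

Lemma poly_expRN_bounded P : exists2 C, 0 <= C &
  forall s, 0 < s -> `|P.[s] * expR (- s)| <= C.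
Proof.
(* The extra power of s makes the induction work: in the Horner form P X + c, the factor s is moved
   from the polynomial into the power. *)
suff h m : exists2 C, 0 <= C & forall s, 0 < s -> `|P.[s]| * (s ^+ m * expR (- s)) <= C.
  have [C C0 hC] := h 0%N; exists C => // s s0.
  by rewrite normrM (ger0_norm (expR_ge0 _)) -[expR _]mul1r; exact: hC.
elim/poly_ind: P m => [|P c IH] m.
  by exists 0 => // s _; rewrite horner0 normr0 mul0r.
have [C C0 hC] := IH m.+1.
exists (C + `|c| * m`!%:R); first by rewrite addr_ge0// mulr_ge0.
move=> s s0; rewrite hornerMXaddC.
have sm0 : 0 <= s ^+ m * expR (- s) by rewrite mulr_ge0 ?expR_ge0 ?exprn_ge0 ?ltW.
rewrite (@le_trans _ _ ((`|P.[s] * s| + `|c|) * (s ^+ m * expR (- s))))//.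
  by rewrite ler_wpM2r// ler_normD.
rewrite mulrDl lerD//; last by rewrite ler_wpM2l// pow_expRN_le.
rewrite (le_trans _ (hC s s0))// normrM (gtr0_norm s0) exprS.
by rewrite !mulrA.
Qed.

Lemma is_derive_flat P x : is_derive x (1 : R) (flat P) (flat (flat_next P) x).
Proof.
have [x0|x0|x0] := ltgtP 0 x.
- have -> : flat (flat_next P) x =
      (- x ^- 2) * (P^`().[x^-1] * expR (- x^-1) - P.[x^-1] * expR (- x^-1)).
    by rewrite /flat x0 /flat_next !hornerE -exprVn; ring.
  apply: (@near_eq_is_derive _ _ _ ((fun u => P.[u] * expR (- u)) \o (fun y : R => y^-1))).
    near=> y; have y0 : 0 < y by near: y; exact: (cvgr_gt x).
    by rewrite /flat y0.
  have xn0 : x != 0 by rewrite gt_eqF.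
  have d1 : is_derive x (1 : R) (fun y : R => y^-1) (- x ^- 2).
    apply: DeriveDef; first by apply: derivableV => //; exact: derivable_id.
    by rewrite deriveV// derive_id -[_ *: _]/(_ * _) mulr1.
  have d2 : is_derive (x^-1) (1 : R) (fun u => P.[u] * expR (- u))
      (P^`().[x^-1] * expR (- x^-1) - P.[x^-1] * expR (- x^-1)).
    have dN : is_derive (x^-1) (1 : R) (expR \o -%R) (expR (- x^-1) * -1).
      exact: is_derive1_comp.
    have dM := is_deriveM (is_derive_poly P x^-1) dN.
    apply: (is_derive_eq dM).
    by rewrite /= -![_ *: _]/(_ * _); ring.
  apply: (is_derive_eq (is_derive1_comp d2 d1)).
  by rewrite mulrC.
- rewrite [flat _ x]/flat ltNge (ltW x0)/=.
  apply: (@near_eq_is_derive _ _ _ (cst 0)) => //.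
  near=> y; have y0 : y < 0 by near: y; exact: (cvgr_lt x).
  by rewrite /flat ltNge (ltW y0).
- rewrite -{}x0 [flat (flat_next P) _]/flat ltxx.
  (* At 0, for a step h > 0, the difference quotient is h times the value at 1/h of the bounded
     function s^2 P(s) exp(-s), so it tends to 0. *)
  have [C C0 hC] := poly_expRN_bounded ('X^2 * P).
  have h : h^-1 *: ((flat P \o shift 0) (h *: (1 : R)) - flat P 0) @[h --> 0^'] --> (0 : R).
    apply/cvgrPdist_le => e e0; near=> h.
    have hn0 : h != 0 by near: h; exact: nbhs_dnbhs_neq.
    have heC : `|h| < e / (C + 1).
      near: h; apply: dnbhs0_lt.
      by rewrite divr_gt0// ltr_wpDl.
    rewrite sub0r normrN /= addr0 -[h%:A]/(h * 1) mulr1.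
    rewrite [flat P 0]/flat ltxx subr0 -[_ *: _]/(_ * _) /flat.
    case: ifPn => h0; last by rewrite mulr0 normr0 ltW.
    have := hC h^-1; rewrite invr_gt0 => /(_ h0).
    rewrite hornerM hornerXn => hb.
    have -> : h^-1 * (P.[h^-1] * expR (- h^-1)) =
        h * (h^-1 ^+ 2 * P.[h^-1] * expR (- h^-1)) by field.
    rewrite normrM (@le_trans _ _ (e / (C + 1) * C))//.
      by rewrite ler_pM// ltW.
    rewrite mulrAC ler_pdivrMr ?ltr_wpDl//.
    by rewrite ler_wpM2l ?lerDl// ltW.
  apply: DeriveDef; first by apply/cvg_ex; exists 0.
  by apply/cvg_lim.
Unshelve. all: by end_near. Qed.

End bump.

(** * Smooth bumps and mollifiers *)

Section mollifier.
Context {R : realType} {n : nat}.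
Local Notation E := 'rV[R]_n.
Local Notation leb := (lebesgue_row n).
Implicit Types (f : E -> R) (r : R) (i : 'I_n).

Lemma smooth_flat_coord (a b : R) i : smooth (fun x : E => flat 1 (a * x 0 i + b)).
Proof.
pose D m (s : R) := a ^+ m * flat (iter m (@flat_next R) 1) (a * s + b).
have -> : (fun x : E => flat 1 (a * x 0 i + b)) = (fun x : E => D 0%N (x 0 i)).
  by apply/funext => x; rewrite /D expr0 mul1r.
move=> k; apply: isCk_coord => m s.
have da : is_derive s (1 : R) (fun s => a * s + b) a.
  have d1 : is_derive s (1 : R) (fun s => a * s + b) (a *: 1 + 0).
    exact: (is_deriveD (is_deriveZ a (is_derive_id s 1)) (is_derive_cst b s 1)).
  by apply: (is_derive_eq d1); rewrite addr0 -[_ *: _]/(_ * _) mulr1.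
have dc := is_derive1_comp (g := fun s => a * s + b)
  (is_derive_flat (iter m (@flat_next R) 1) (a * s + b)) da.
have := is_deriveZ (a ^+ m) dc; move/is_derive_eq; apply;
  rewrite /D -[_ *: _]/(_ * _) iterS exprSr; ring.
Qed.

Lemma smoothM (f g : E -> R) : smooth f -> smooth g -> smooth (f \* g).
Proof. by move=> sf sg k; exact: isCkM. Qed.

(** A product over the coordinates of flat(r + x_i) flat(r - x_i), positive exactly on the open
    sup-norm ball when r > 0. The factors have the affine form of [smooth_flat_coord]. *)
Definition bump r (x : E) : R :=
  \prod_(i < n) (flat 1 (1 * x 0 i + r) * flat 1 (-1 * x 0 i + r)).

Lemma smooth_bump r : smooth (bump r).
Proof.
move=> k; apply: isCk_prod => i.
by apply: smoothM; exact: smooth_flat_coord.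
Qed.

Lemma flat1_gt0 (s : R) : 0 < s -> 0 < flat 1 s.
Proof. by move=> s0; rewrite /flat s0 hornerC mul1r expR_gt0. Qed.

Lemma flat1_le0 (s : R) : s <= 0 -> flat 1 s = 0.
Proof. by move=> s0; rewrite /flat ltNge s0. Qed.

Lemma flat1_ge0 (s : R) : 0 <= flat 1 s.
Proof.
by have [/flat1_gt0/ltW//|/flat1_le0->] := ltP 0 s.
Qed.

Lemma bump_ge0 r x : 0 <= bump r x.
Proof. by apply: prodr_ge0 => i _; rewrite mulr_ge0 ?flat1_ge0. Qed.

Lemma bump_gt0 r x : `|x| < r -> 0 < bump r x.
Proof.
move=> xr; apply: prodr_gt0 => i _.
have := le_lt_trans (norm_coord_le x i) xr.
by rewrite ltr_norml => /andP[h1 h2]; rewrite mulr_gt0// flat1_gt0//; lra.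
Qed.

Lemma bsupp_bump r : 0 < r -> bsupp r (bump r).
Proof.
move=> r0 x rx; have [[i ri]|] := pselect (exists i, r <= `|x 0 i|).
  rewrite /bump (bigD1 i)//=; apply/eqP; rewrite mulf_eq0; apply/orP; left.
  have := ri; rewrite ler_normr => /orP[h|h].
    by rewrite (flat1_le0 (s := -1 * _ + _)) ?mulr0//; lra.
  by rewrite (flat1_le0 (s := 1 * _ + _)) ?mul0r//; lra.
move=> /forallNP h; exfalso; move: rx; rewrite leNgt => /negP; apply.
rewrite /Num.norm/= mx_normrE; apply/bigmax_ltP; split => // -[a b] _ /=.
by rewrite ord1 ltNge; apply/negP.
Qed.

Lemma mollifier_exists r : 0 < r -> exists rho : E -> R,
  [/\ smooth rho, forall x, 0 <= rho x, bsupp r rho & \int[leb]_x rho x = 1].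
Proof.
move=> r0; have cb := isCk_continuous (@smooth_bump r 0%N).
have mb := continuous_measurable_row cb.
have [C C0 bC] := continuous_bounded cb (bsupp_bump r0).
have bi := L1_bounded mb bC (bsupp_bump r0).
have ib : 0 < \int[leb]_x bump r x.
  rewrite lt_neqAle Rintegral_ge0 ?andbT//; last by move=> x _; exact: bump_ge0.
  (* If the integral were 0, the bump would vanish almost everywhere; but it is positive on a ball,
     whose measure is positive as that of a box. *)
  apply/eqP => /esym b0.
  have : (\int[leb]_x `|(bump r x)%:E| = 0)%E.
    rewrite -[RHS]/(0%:E) -b0 fineK; last exact: integrable_fin_num.
    by apply: eq_integral => x _; rewrite gee0_abs// lee_fin bump_ge0.
  move/(ae_eq_integral_abs _ measurableT (proj2 (measurable_EFinP _ _) mb)).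
  move=> [A [mA A0 hA]].
  have : (leb (ball (0%R : E) r) <= leb A)%E.
    apply: le_measure; rewrite ?inE//; first exact: measurable_row_ball.
    move=> x; rewrite -ball_normE /= sub0r normrN => xr; apply: hA => /=.
    by move=> h; have := bump_gt0 xr; have [->] := h Logic.I; rewrite ltxx.
  rewrite [X in (_ <= X)%E]A0.
  rewrite (_ : ball (0 : E) r = [set y : E | forall i, ball (0 : R) r (y 0 i)]); last first.
    apply/seteqP; split => [y [_ xy] i|y xy]; first by have := xy 0 i; rewrite mxE.
    by split=> // i j; rewrite ord1 mxE; exact: xy.
  rewrite (lebesgue_row_box (A := fun=> ball (0 : R) r)); last first.
    by move=> i; exact: measurable_ball.
  under eq_bigr do rewrite lebesgue_measure_ball ?(ltW r0)//.
  rewrite prodEFin lee_fin leNgt => /negP; apply.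
  by apply: prodr_gt0 => i _; rewrite mulrn_wgt0.
exists ((\int[leb]_x bump r x)^-1 *: bump r); split.
- by move=> k; apply: isCkZ; exact: smooth_bump.
- by move=> x; rewrite mulr_ge0 ?bump_ge0// invr_ge0 ltW.
- by move=> x rx; rewrite -[LHS]/(_ * _) bsupp_bump// mulr0.
- rewrite RintegralZl//.
  by rewrite mulVf// gt_eqF.
Qed.

End mollifier.

(** * Smoothness and approximation properties of mollification *)

Section mollification.
Context {R : realType} {n : nat}.
Local Notation E := 'rV[R]_n.
Local Notation e_ i := (delta_mx 0 i : E).
Local Notation leb := (lebesgue_row n).
Implicit Types (f rho xi : E -> R) (r L M C : R) (i : 'I_n).

(** Convolution with the reflected kernel; each derivative in x therefore brings a minus sign on the
    derivative of [rho]. *)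
Definition mollify rho xi : E -> R := fun x => \int[leb]_y (rho (y - x) * xi y).

Lemma mollify_L1 r M rho xi x : continuous rho -> bsupp r rho ->
  continuous xi -> bsupp M xi -> L1 setT (fun y => rho (y - x) * xi y).
Proof.
move=> cr rr cx xM.
have [C C0 hC] := continuous_bounded cr rr.
have [D D0 hD] := continuous_bounded cx xM.
apply: (@L1_bounded _ _ (C * D) M).
- apply: measurable_funM; last exact: continuous_measurable_row.
  apply: (@measurableT_comp _ _ _ _ _ _ rho); first exact: continuous_measurable_row.
  exact: measurable_fun_translate.
- by move=> y; rewrite normrM ler_pM.
- by move=> y My; rewrite xM// mulr0.
Qed.

(** The Lipschitz constant comes from the kernel, which may have any sign and mass; this gives the
    continuity of all derivatives of a mollification. The sharper [mollify_contract] keeps the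
    constant of [xi]. *)
Lemma mollify_Lip r M L rho xi : 0 <= L -> Lip L rho -> bsupp r rho ->
  continuous xi -> bsupp M xi ->
  Lip (L * \int[leb]_y `|xi y|) (mollify rho xi).
Proof.
move=> L0 rL rr cx xM x x'; have cr := Lip_continuous rL.
have [D D0 hD] := continuous_bounded cx xM.
have xii : L1 setT xi by apply: L1_bounded hD xM; exact: continuous_measurable_row.
have i1 := mollify_L1 x cr rr cx xM; have i2 := mollify_L1 x' cr rr cx xM.
rewrite /mollify -RintegralB// (le_trans (le_normr_Rintegral _ _))//; first exact: L1B.
rewrite mulrAC -RintegralZl//; last exact: L1_abs.
apply: le_Rintegral => //.
- exact/L1_abs/L1B.
- exact/L1Z/L1_abs.
move=> y _; rewrite -mulrBl normrM ler_wpM2r// (le_trans (rL _ _))//.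
by rewrite opprB addrC subrKA distrC.
Qed.

Lemma mollify_dquot r M rho xi i h x : continuous rho -> bsupp r rho ->
  continuous xi -> bsupp M xi ->
  dquot (e_ i) (mollify rho xi) h x =
  \int[leb]_y (- dquot (e_ i) rho (- h) (y - x) * xi y).
Proof.
move=> cr rr cx xM.
have i1 := mollify_L1 (h *: e_ i + x) cr rr cx xM; have i2 := mollify_L1 x cr rr cx xM.
rewrite {1}/dquot /mollify -RintegralB// -RintegralZl//; last exact: L1B.
apply: eq_Rintegral => y _; rewrite /dquot invrN.
rewrite (_ : - h *: e_ i + (y - x) = y - (h *: e_ i + x)); last first.
  by rewrite scaleNr opprD addrCA.
ring.
Qed.

Lemma mollify_derive r M rho xi i x : isCk 1 rho -> bsupp r rho ->
  continuous xi -> bsupp M xi ->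
  dquot (e_ i) (mollify rho xi) h x @[h --> 0^'] -->
  mollify (fun z => - pderiv i rho z) xi x.
Proof.
move=> Cr rr cx xM; have cr := isCk_continuous Cr.
have [L L0 rL] := C1_Lip Cr rr.
have [D D0 hD] := continuous_bounded cx xM.
apply/cvgr_dnbhsP => t [t0 tc].
rewrite (_ : (fun k => _) = fun k => \int[leb]_y (- dquot (e_ i) rho (- t k) (y - x) * xi y));
  last by apply/funext => k; exact: mollify_dquot cr rr cx xM.
have mt (f : E -> R) : measurable_fun setT f ->
      measurable_fun setT (fun y : E => - f (y - x) * xi y).
  move=> mf; apply: measurable_funM; last exact: continuous_measurable_row.
  apply: measurableT_comp => //.
  by apply: (measurableT_comp mf); exact: measurable_fun_translate.
have [] := @Rintegral_dominated _ _ (L * D) M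
  (fun k y => - dquot (e_ i) rho (- t k) (y - x) * xi y)
  (fun y => - pderiv i rho (y - x) * xi y) => //.
- by move=> k; apply: mt; exact: dquot_measurable.
- by apply: mt; exact: measurable_pderiv.
- move=> k y; rewrite normrM ler_pM// normrN (le_trans (dquot_le _ _ _ L0 rL))//.
  by rewrite ler_piMr// norm_delta_le1.
- by move=> k y My; rewrite xM// mulr0.
- apply: aeW => y.
  have c1 : dquot (e_ i) rho (- t k) (y - x) @[k --> \oo] --> pderiv i rho (y - x).
    have /cvgr_dnbhsP : dquot (e_ i) rho h (y - x) @[h --> 0^'] --> pderiv i rho (y - x).
      exact: isCk_derivable Cr.
    apply; split; first by move=> k; rewrite oppr_eq0.
    by rewrite -oppr0; exact: cvgN.
  exact: cvgM (cvgN c1) (cvg_cst _).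
Qed.

Lemma mollify_derivable r M rho xi i x : isCk 1 rho -> bsupp r rho ->
  continuous xi -> bsupp M xi -> derivable (mollify rho xi) x (e_ i).
Proof.
move=> Cr rr cx xM; rewrite derivableE; apply/cvg_ex.
exists (mollify (fun z => - pderiv i rho z) xi x).
exact: (@mollify_derive r M rho xi i x Cr rr cx xM).
Qed.

Lemma mollify_pderiv r M rho xi i : isCk 1 rho -> bsupp r rho ->
  continuous xi -> bsupp M xi ->
  pderiv i (mollify rho xi) = mollify (fun z => - pderiv i rho z) xi.
Proof.
move=> Cr rr cx xM; apply/funext => x; rewrite /pderiv deriveE.
by apply/cvg_lim => //; exact: (@mollify_derive r M rho xi i x Cr rr cx xM).
Qed.

Lemma smooth_mollify r M rho xi : smooth rho -> bsupp r rho ->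
  continuous xi -> bsupp M xi -> smooth (mollify rho xi).
Proof.
move=> sr rr cx xM k.
have cm rho' r' : smooth rho' -> bsupp r' rho' -> continuous (mollify rho' xi).
  move=> sr' rr'; have [L L0 rL] := C1_Lip (sr' 1%N) rr'.
  exact: Lip_continuous (mollify_Lip L0 rL rr' cx xM).
(* The kernel and its radius are generalised, since a derivative of the mollification is the
   mollification by minus a derivative of the kernel. *)
elim: k r rho sr rr => [|k IH] r rho sr rr /=; first exact: cm sr rr.
split; first exact: cm sr rr.
move=> i; split=> [x|]; first exact: mollify_derivable (sr 1%N) rr cx xM.
rewrite (mollify_pderiv i (sr 1%N) rr cx xM); apply: (IH (r + 1)).
  move=> j; rewrite (_ : (fun z => _) = -1 *: pderiv i rho).
    by apply/isCkZ/isCk_pderiv/sr.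
  by apply/funext => z; rewrite -[RHS]/(_ * _) mulN1r.
by move=> z rz; rewrite (bsupp_derive i rr)// oppr0.
Qed.

Section approximation.
Variables (rho xi : E -> R) (r L M : R).
Hypotheses (srho : smooth rho) (rho0 : forall x, 0 <= rho x) (rrho : bsupp r rho).
Hypothesis rho1 : \int[leb]_x rho x = 1.
Hypotheses (xiL : Lip L xi) (xiM : bsupp M xi).

Let crho : continuous rho := isCk_continuous (srho 0%N).
Let cxi : continuous xi := Lip_continuous xiL.
Let mrho := continuous_measurable_row crho.

Let irho : L1 setT rho.
Proof.
have [C C0 hC] := continuous_bounded crho rrho.
exact: L1_bounded hC rrho.
Qed.

Let Rintegral_rho x : \int[leb]_y rho (y - x) = 1.
Proof. by rewrite -rho1 (Rintegral_row_translate (- x)). Qed.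

(** The mollification at x is an average of [xi] over the ball of radius r. With c = [xi x] this
    gives the rate of uniform convergence; with d = 0 it locates supports and the sets where a
    mollification is constant. *)
Lemma mollify_near x (c d : R) : 0 <= d ->
  (forall y, `|y - x| < r -> `|xi y - c| <= d) -> `|mollify rho xi x - c| <= d.
Proof.
move=> d0 xc.
have i1 := mollify_L1 x crho rrho cxi xiM.
have i2 : L1 setT (fun y => rho (y - x)) by exact: L1_translate.
have i2c : L1 setT (fun y => c * rho (y - x)) by exact: L1Z.
have i2d : L1 setT (fun y => d * rho (y - x)) by exact: L1Z.
have cE a : a = \int[leb]_y (a * rho (y - x)).
  by rewrite RintegralZl// Rintegral_rho mulr1.
rewrite (cE c) (cE d) /mollify -RintegralB// (le_trans (le_normr_Rintegral _ _))//.
  exact: L1B.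
apply: le_Rintegral => //; first exact/L1_abs/L1B.
move=> y _; rewrite (mulrC c) -mulrBr normrM (ger0_norm (rho0 _)) mulrC.
have [yx|yx] := ltP `|y - x| r; first by rewrite ler_wpM2r// xc.
by rewrite rrho// !mulr0.
Qed.

(** After translation, the mollification is an average of translates of [xi], all with the constant
    L. *)
Lemma mollify_contract : Lip L (mollify rho xi).
Proof.
move=> x x'.
have mE z : mollify rho xi z = \int[leb]_y (rho y * xi (y + z)).
  rewrite -[RHS](Rintegral_row_translate (- z)).
    by apply: eq_Rintegral => y _; rewrite subrK.
  apply: measurable_funM => //.
  apply: (@measurableT_comp _ _ _ _ _ _ xi); first exact: continuous_measurable_row.
  exact: measurable_fun_translate.
have iz z : L1 setT (fun y => rho y * xi (y + z)).
  have := L1_translate z (mollify_L1 z crho rrho cxi xiM).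
  by under eq_fun do rewrite addrK.
have ix := iz x; have ix' := iz x'.
rewrite !mE -RintegralB// (le_trans (le_normr_Rintegral _ _))//; first exact: L1B.
rewrite -[leRHS]mulr1 -rho1 -RintegralZl//.
apply: le_Rintegral => //; [exact/L1_abs/L1B|exact: L1Z|].
move=> y _; rewrite -mulrBr normrM (ger0_norm (rho0 _)) mulrC ler_wpM2r//.
by rewrite (le_trans (xiL _ _))// opprD addrACA subrr add0r.
Qed.

End approximation.
End mollification.

(** * Cut-off functions *)

Section supports.
Context {R : realType} {n : nat}.
Local Notation E := 'rV[R]_n.
Implicit Types (f g xi : E -> R) (r L M C : R) (K Omega : set E).

Lemma subset_tsupport f x : f x != 0 -> tsupport f x.
Proof. by move=> fx; exact: subset_closure. Qed.

Lemma tsupport_out f x : ~ tsupport f x -> f x = 0.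
Proof. by apply: contra_notP => /eqP; exact: subset_tsupport. Qed.

Lemma compact_in_ball K : compact K -> exists2 M, 0 <= M & forall x, K x -> `|x| < M.
Proof.
move=> /compact_bounded[M [Mr hM]]; exists (`|M| + 2); first by rewrite addr_ge0.
move=> x Kx; rewrite (@le_lt_trans _ _ (`|M| + 1))//; last by rewrite ltrD2l ltr1n.
by apply: hM Kx; rewrite (le_lt_trans (ler_norm M))// ltrDl.
Qed.

Lemma compact_bsupp f : compact (tsupport f) -> exists2 M, 0 <= M & bsupp M f.
Proof.
move=> /compact_in_ball[M M0 hM]; exists M => // x Mx; apply: tsupport_out.
by move=> /hM; rewrite ltNge Mx.
Qed.

Lemma compact_support_in_subset Omega f K : compact K -> K `<=` Omega ->
  (forall x, f x != 0 -> K x) -> compact_support_in Omega f.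
Proof.
move=> cK KO fK.
have sub : tsupport f `<=` K.
  rewrite [X in _ `<=` X](proj1 (closure_id K)).
    by apply: closureS => x; exact: fK.
  exact: compact_closed row_hausdorff cK.
split; last exact: subset_trans sub KO.
by apply: subclosed_compact cK sub; exact: closed_closure.
Qed.

Lemma compact_support_inM Omega f g :
  compact_support_in Omega f -> compact_support_in Omega (f \* g).
Proof.
move=> [cf fO]; apply: compact_support_in_subset cf fO _ => x.
by rewrite mulf_eq0 negb_or => /andP[/subset_tsupport].
Qed.

Lemma compact_open_margin K Omega : compact K -> open Omega -> K `<=` Omega ->
  exists2 d, 0 < d & forall x, K x -> ball x d `<=` Omega.
Proof.
move=> /compact_near_coveringP cK oO KO.
have := cK R (0^'+) (fun e x => ball x e `<=` Omega) _ _.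
case=> [x Kx|d /= d0 hd].
  have /nbhs_ballP[e /= e0 he] := oO x (KO x Kx).
  exists (ball x (e / 2), [set t | t < e / 2]) => /=.
    split; first by apply: nbhsx_ballx; rewrite divr_gt0.
    by apply: nbhs_right_lt; rewrite divr_gt0.
  move=> [y t] /= [xy te] z yz; apply: he; rewrite [e]splitr.
  apply: ball_triangle xy _.
  by move: yz; apply: le_ball; exact: ltW.
exists (d / 2) => //=; first by rewrite divr_gt0.
apply: (hd (d / 2)) => /=; last by rewrite divr_gt0.
by rewrite sub0r normrN gtr0_norm ?divr_gt0// gtr_pMr// invf_lt1// ltr1n.
Qed.

(** One compact set that contains the supports of all mollifications at scales at most d. *)
Lemma compact_thickening K Omega : compact K -> open Omega -> K `<=` Omega ->
  exists K' d, [/\ compact K', K' `<=` Omega, 0 < d &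
    forall x y, K x -> `|y - x| < d -> K' y].
Proof.
move=> cK oO KO; have [d d0 hd] := compact_open_margin cK oO KO.
have [M M0 hM] := compact_in_ball cK.
pose T := [set y : E | exists2 x, K x & `|y - x| < d / 2].
have d20 : 0 < d / 2 by rewrite divr_gt0.
exists (closure T), (d / 2); split => //.
- apply: bounded_closed_compact; last exact: closed_closure.
  exists (M + d); split; first exact: num_real.
  move=> k Mk y Ty; have /Ty[z [[x Kx zx] yz]] : nbhs y (ball y (d / 2)).
    exact: nbhsx_ballx.
  rewrite /= (le_trans _ (ltW Mk))//.
  move: yz; rewrite -ball_normE /= => yz.
  have -> : y = (y - z) + (z - x) + x by rewrite subrKA subrK.
  rewrite (le_trans (ler_normD _ _))// addrC lerD//; first exact/ltW/hM.
  by rewrite (le_trans (ler_normD _ _))// [leRHS]splitr lerD// ltW.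
- move=> y Ty; have /Ty[z [[x Kx zx] yz]] : nbhs y (ball y (d / 2)).
    exact: nbhsx_ballx.
  apply: (hd _ Kx); move: yz; rewrite -!ball_normE /= => yz.
  rewrite -(subrKA z) (le_lt_trans (ler_normD _ _))// [ltRHS]splitr.
  by rewrite ltrD// distrC.
- by move=> x y Kx yx; apply: subset_closure; exists x.
Qed.

Lemma smooth_approximation L K Omega xi : 0 <= L -> Lip L xi ->
  compact K -> open Omega -> K `<=` Omega -> (forall x, xi x != 0 -> K x) ->
  exists (K' : set E) (zeta : nat -> E -> R),
    [/\ compact K', K' `<=` Omega & forall k, [/\ smooth (zeta k), Lip L (zeta k),
    forall x, `|zeta k x - xi x| <= L * k.+1%:R^-1 &
    forall x, zeta k x != 0 -> K' x]].
Proof.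
move=> L0 xiL cK oO KO xiK.
have [K' [d [cK' K'O d0 hd]]] := compact_thickening cK oO KO.
have [M M0 hM] := compact_in_ball cK.
have xiM : bsupp M xi.
  move=> x Mx; apply/eqP; rewrite -[_ == _]negbK; apply/negP => /xiK/hM.
  by rewrite ltNge Mx.
have cxi := Lip_continuous xiL.
suff /choice[zeta hz] : forall k : nat, exists zeta, [/\ smooth zeta, Lip L zeta,
    forall x, `|zeta x - xi x| <= L * k.+1%:R^-1 & forall x, zeta x != 0 -> K' x].
  by exists K', zeta; split.
(* The bound d keeps the supports in the fixed compact set [K']; the bound 1/(k+1) gives the
   rate. *)
move=> k; pose r := Num.min d k.+1%:R^-1.
have r0 : 0 < r by rewrite /r lt_min d0/= invr_gt0.
have [rho [srho rho0 rrho rho1]] := @mollifier_exists R n r r0.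
exists (mollify rho xi); split.
- exact: smooth_mollify srho rrho cxi xiM.
- exact: mollify_contract srho rho0 rrho rho1 xiL xiM.
- move=> x; apply: (mollify_near srho rho0 rrho rho1 xiL xiM).
    by rewrite mulr_ge0.
  move=> y yx; rewrite (le_trans (xiL _ _))// ler_wpM2l// (le_trans (ltW yx))//.
  by rewrite /r ge_min lexx orbT.
- move=> x; apply: contraNP => K'x.
  have := mollify_near srho rho0 rrho rho1 xiL xiM (x := x) (c := 0) (lexx 0).
  rewrite subr0 normr_le0; apply => y yx; rewrite subr0 normr_le0.
  apply: contra_notT K'x => /xiK Ky; apply: (hd _ _ Ky).
  by rewrite distrC (lt_le_trans yx)// /r ge_min lexx.
Qed.

Lemma smooth_cutoff (c : E) r : 0 < r -> exists b : E -> R,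
  [/\ smooth b, forall x, `|x - c| < r -> b x = 1 &
     forall x, 4 * r <= `|x - c| -> b x = 0].
Proof.
move=> r0.
(* A tent equal to 1 up to radius 2r and to 0 from radius 3r. Mollifying at scale r loses r on both
   sides, whence the radii r and 4r of the statement. *)
pose xi (x : E) : R := Num.min 1 (Num.max 0 (3 - `|x - c| / r)).
have xi1 x : `|x - c| <= 2 * r -> xi x = 1.
  move=> xc; have h : `|x - c| / r <= 2 by rewrite ler_pdivrMr.
  have h1 : 1 <= 3 - `|x - c| / r by lra.
  by rewrite /xi; apply/min_idPl; rewrite le_max h1 orbT.
have xi0 x : 3 * r <= `|x - c| -> xi x = 0.
  move=> xc; have h : 3 <= `|x - c| / r by rewrite ler_pdivlMr.
  have h1 : 3 - `|x - c| / r <= 0 by lra.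
  rewrite /xi (max_idPl h1).
  by apply/min_idPr.
have minL (a b : R) : `|Num.min 1 (Num.max 0 a) - Num.min 1 (Num.max 0 b)| <= `|a - b|.
  have := ler_norm (a - b); have := ler_norm (b - a); rewrite [`|b - a|]distrC.
  rewrite !minEle !maxEle; case: (leP 0 a); case: (leP 0 b); case: (leP 1 a);
    case: (leP 1 b); rewrite ?ler10 ?ler01 => *; rewrite ler_norml; lra.
have xiL : Lip r^-1 xi.
  move=> x y; rewrite (le_trans (minL _ _))//.
  rewrite opprD addrACA subrr add0r opprK addrC -mulrBl normrM mulrC.
  rewrite ger0_norm ?invr_ge0 ?(ltW r0)// ler_wpM2l ?invr_ge0 ?(ltW r0)//.
  by rewrite (le_trans (ler_dist_dist _ _))// opprB subrKA distrC.
have xiM : bsupp (`|c| + 3 * r) xi.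
  move=> x h; apply: xi0; rewrite (le_trans _ (lerB_dist _ _))//.
  by rewrite lerBrDl.
have cxi := Lip_continuous xiL.
have [rho [srho rho0 rrho rho1]] := @mollifier_exists R n r r0.
have near x t : (forall y, `|y - x| < r -> xi y = t) -> mollify rho xi x = t.
  move=> h; apply/eqP; rewrite -subr_eq0 -normr_le0.
  apply: (mollify_near srho rho0 rrho rho1 xiL xiM) => // y yx.
  by rewrite h// subrr normr0.
exists (mollify rho xi); split.
- exact: smooth_mollify srho rrho cxi xiM.
- move=> x xc; apply: near => y yx; apply: xi1.
  rewrite -(subrKA x) (le_trans (ler_normD _ _))// mulr_natl mulr2n.
  by rewrite lerD// ltW.
- move=> x xc; apply: near => y yx; apply: xi0.
  move: yx; rewrite distrC => yx.
  by have := ler_normD (x - y) (y - c); rewrite subrKA; lra.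
Qed.

(** This plays the role of a partition of unity. Along a finite cover by balls, split [xi] as [xi] b
    + [xi] (1 - b) with b a cut-off at the first ball: the first term is supported near that ball,
    and the second lives on the remaining ones. *)
Lemma smooth_localization Omega (Q : (E -> R) -> Prop) : open Omega ->
  Q 0 ->
  (forall f g, smooth f -> compact_support_in Omega f ->
     smooth g -> compact_support_in Omega g -> Q f -> Q g -> Q (f + g)) ->
  (forall x, Omega x -> exists2 r, 0 < r & forall xi, smooth xi ->
     compact_support_in Omega xi -> (forall y, xi y != 0 -> `|y - x| < r) -> Q xi) ->
  forall xi, smooth xi -> compact_support_in Omega xi -> Q xi.
Proof.
move=> oO Q0 QD Qloc xi sxi cxi.
have /choice[r hr] x : exists r, Omega x -> 0 < r /\ forall xi, smooth xi ->
     compact_support_in Omega xi -> (forall y, xi y != 0 -> `|y - x| < r) -> Q xi.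
  have [/Qloc[r r0 h]|nx] := pselect (Omega x); last by exists 0.
  by exists r.
have [cK KO] := cxi.
(* A cut-off equal to 1 on the ball of radius r/4 vanishes from radius r on, which is the size
   allowed by the local hypothesis. *)
have := cK; rewrite compact_cover => /(_ _ (tsupport xi) (fun x => ball x (r x / 4))).
case => [x Kx|x Kx|D DK xiD].
- exact: ball_open.
- exists x => //; apply: ballxx; rewrite divr_gt0//.
  by have [] := hr x (KO x Kx).
have : forall y, xi y != 0 -> exists2 x, x \in finmap.enum_fset D & ball x (r x / 4) y.
  by move=> y /subset_tsupport/xiD[x /= xD xy]; exists x.
have : forall x, x \in finmap.enum_fset D -> Omega x.
  by move=> x xD; apply: KO; have := DK x xD; rewrite inE.
elim: (finmap.enum_fset D) xi sxi cxi {cK KO DK xiD} => [|x s IH] xi sxi cxi sO xis.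
  rewrite (_ : xi = 0)//; apply/funext => y; apply/eqP; rewrite -[_ == _]negbK.
  by apply/negP => /xis[].
have [r0 Qx] := hr x (sO x (mem_head _ _)).
have r40 : 0 < r x / 4 by rewrite divr_gt0.
have [b [sb b1 b0]] := smooth_cutoff x r40.
have sb' : smooth (fun y => 1 - b y).
  move=> k; rewrite (_ : (fun y => _) = (fun=> 1) + (-1) *: b).
    by apply: isCkD; [exact: isCk_cst|exact: isCkZ].
  by apply/funext => y; rewrite -[RHS]/(1 + -1 * b y) mulN1r.
have -> : xi = (xi \* b) + (xi \* (fun y => 1 - b y)).
  apply/funext => y; rewrite -[RHS]/(xi y * b y + xi y * (1 - b y)).
  by rewrite -mulrDr addrC subrK mulr1.
apply: QD.
- exact: smoothM.
- exact: compact_support_inM.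
- exact: smoothM.
- exact: compact_support_inM.
- apply: Qx; [exact: smoothM|exact: compact_support_inM|].
  move=> y; rewrite mulf_eq0 negb_or => /andP[_ by0]; rewrite ltNge.
  apply: contraNN by0 => xy; apply/eqP/b0.
  by rewrite mulrCA mulfV// mulr1.
- apply: IH; [exact: smoothM|exact: compact_support_inM| |].
    by move=> y ys; apply: sO; rewrite inE ys orbT.
  move=> y; rewrite mulf_eq0 negb_or => /andP[/xis[z + zy] by0].
  rewrite inE => /orP[/eqP zx|zs]; last by exists z.
  exfalso; move: by0; rewrite b1 ?subrr ?eqxx// distrC.
  by move: zy; rewrite zx -ball_normE.
Qed.

End supports.

(** * The energy form *)

Section L1_tools.
Context {R : realType} {n : nat}.
Local Notation E := 'rV[R]_n.
Local Notation leb := (lebesgue_row n).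
Implicit Types (f g v : E -> R) (A B K Omega : set E) (C : R).

Lemma L1_extend A B f : measurable A -> measurable B -> B `<=` A ->
  (forall x, A x -> ~ B x -> f x = 0) -> L1 B f ->
  L1 A f /\ \int[leb]_(x in A) f x = \int[leb]_(x in B) f x.
Proof.
move=> mA mB BA f0 fB.
have fE : f \_ A = f \_ B.
  apply/funext => x; rewrite !patchE.
  have [xB|xB] := boolP (x \in B).
    by rewrite (mem_set (BA _ (set_mem xB))).
  case: ifPn => // xA; apply: f0; first exact: set_mem.
  by move/mem_set; apply/negP.
split; last by rewrite Rintegral_mkcond fE -Rintegral_mkcond.
move: fB; rewrite /L1 => /(integrable_mkcond _ mB) fB.
apply/(integrable_mkcond _ mA).
by rewrite restrict_EFin fE -restrict_EFin.
Qed.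

Lemma L1_mul_bounded C A v f : measurable A -> L1 A v -> measurable_fun A f ->
  (forall x, A x -> `|f x| <= C) ->
  L1 A (v \* f) /\ `|\int[leb]_(x in A) (v x * f x)| <= C * \int[leb]_(x in A) `|v x|.
Proof.
move=> mA vA mf fC.
have mv := L1_measurable vA.
have vfA : L1 A (v \* f).
  apply: (le_integrable mA _ _ (L1Z C mA (L1_abs vA))).
    by apply/measurable_EFinP; exact: measurable_funM.
  move=> x Ax; rewrite lee_fin /= normrM mulrC.
  have C0 : 0 <= C by rewrite (le_trans _ (fC x Ax)).
  by rewrite normrM normr_id (ger0_norm C0) ler_wpM2r// fC.
split=> //; rewrite (le_trans (le_normr_Rintegral _ _))// -RintegralZl//; last exact: L1_abs.
apply: le_Rintegral => //; [exact: L1_abs|exact/L1Z/L1_abs|].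
by move=> x Ax; rewrite normrM mulrC ler_wpM2r// fC.
Qed.

Lemma Rintegral_ae_eq A f g : measurable A -> measurable_fun A f ->
  measurable_fun A g -> f = g %[ae leb in A] ->
  \int[leb]_(x in A) f x = \int[leb]_(x in A) g x.
Proof.
move=> mA mf mg fg; congr fine; apply: ae_eq_integral => //.
- exact/measurable_EFinP.
- exact/measurable_EFinP.
- by apply: filterS fg => x fg Ax; rewrite /= fg.
Qed.

Lemma L1_ae_eq A f g : measurable A -> L1 A f -> measurable_fun A g ->
  f = g %[ae leb in A] -> L1 A g.
Proof.
move=> mA fA mg fg; have [mf fi] := integrableP _ _ _ fA.
apply/integrableP; split; first exact/measurable_EFinP.
suff -> : (\int[leb]_(x in A) `|(EFin \o g) x| =
    \int[leb]_(x in A) `|(EFin \o f) x|)%E by [].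
apply: ae_eq_integral => //.
- by apply/measurableT_comp => //; exact/measurable_EFinP.
- exact: measurableT_comp.
- by apply: filterS fg => x fg Ax; rewrite /= fg.
Qed.

Lemma Rintegral_norm0_ae A f : measurable A -> L1 A f ->
  \int[leb]_(x in A) `|f x| = 0 -> f = 0 %[ae leb in A].
Proof.
move=> mA fA f0; have : (\int[leb]_(x in A) `|(f x)%:E| = 0)%E.
  rewrite -[RHS]/(0%:E) -f0 fineK; first by [].
  by apply: integrable_fin_num => //; exact: L1_abs.
have mf := L1_measurable fA.
move/(ae_eq_integral_abs _ mA (proj2 (measurable_EFinP _ _) mf)).
by apply: filterS => x h Ax; have [->] := h Ax.
Qed.

Lemma compact_L1loc K Omega v : L1loc Omega v -> compact K -> K `<=` Omega -> L1 K v.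
Proof. by move=> [_ h]; exact: h. Qed.

End L1_tools.

(** * Pairings with locally integrable functions, and the energy form *)

Section energy.
Context {R : realType} {n : nat}.
Local Notation E := 'rV[R]_n.
Local Notation e_ i := (delta_mx 0 i : E).
Local Notation leb := (lebesgue_row n).
Implicit Types (f g v V : E -> R) (A B K Omega : set E) (C L M : R) (i : 'I_n).

Lemma pderiv_tsupport f i x : ~ tsupport f x -> pderiv i f x = 0.
Proof.
move=> fx; transitivity ('D_(e_ i) (cst 0 : E -> R) x); last exact: derive_cst.
apply: near_eq_derive.
have oc : open (~` tsupport f) by apply: closed_openC; exact: closed_closure.
have : nbhs x (~` tsupport f) by exact: open_nbhs_nbhs.
by apply: filterS => y; exact: tsupport_out.
Qed.

Lemma compact_support_pderiv Omega f i :
  compact_support_in Omega f -> compact_support_in Omega (pderiv i f).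
Proof.
move=> [cf fO]; apply: compact_support_in_subset cf fO _ => x.
by move=> h; apply: contrapT => /pderiv_tsupport fx; rewrite fx eqxx in h.
Qed.

Lemma W1oo_cP Omega (w : W1oo_c Omega) : exists L M,
  [/\ 0 <= L, 0 <= M, Lip L w, bsupp M w & compact_support_in Omega w].
Proof.
have /asboolP[/lipschitzP[L L0 wL] wc] : W1oo_fun w \in Lip_c Omega by exact: valP.
have [M M0 wM] := compact_bsupp wc.1.
by exists L, M; split => //; exact: ltW.
Qed.

Lemma W1oo_of L Omega f : Lip L f -> compact_support_in Omega f ->
  exists w : W1oo_c Omega, W1oo_fun w = f.
Proof.
move=> fL fc; have fP : f \in Lip_c Omega.
  by apply/asboolP; split => //; exact: Lip_lipschitz fL.
by exists (MkW1oo_c fP).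
Qed.

(** The common form of the integrals over Omega below: a locally integrable function against a
    bounded one supported in a compact set. *)
Lemma L1loc_mul C K Omega v g : open Omega -> L1loc Omega v -> compact K ->
  K `<=` Omega -> measurable_fun setT g -> (forall x, `|g x| <= C) ->
  (forall x, g x != 0 -> K x) ->
  [/\ L1 Omega (v \* g),
      \int[leb]_(x in Omega) (v x * g x) = \int[leb]_(x in K) (v x * g x) &
      `|\int[leb]_(x in Omega) (v x * g x)| <= C * \int[leb]_(x in K) `|v x| ].
Proof.
move=> oO vO cK KO mg gC gK.
have mK := compact_measurable_row cK.
have [h1 h2] := L1_mul_bounded mK (compact_L1loc vO cK KO) (measurable_funTS mg) (fun x _ => gC x).
have [|h3 h4] := L1_extend (open_measurable_row oO) mK KO _ h1.
  move=> x _ Kx /=; rewrite (_ : g x = 0) ?mulr0//.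
  by apply/eqP; apply: contra_notT Kx => /gK.
by split => //; rewrite h4.
Qed.

Lemma smooth_bounded f Omega : continuous f -> compact_support_in Omega f ->
  exists2 C, 0 <= C & forall x, `|f x| <= C.
Proof.
move=> cf [/compact_bsupp[M M0 fM] _]; exact: continuous_bounded cf fM.
Qed.

Lemma Lip_pderiv_mul_L1 L L' M f g i : 0 <= L -> 0 <= L' -> 
  Lip L f -> Lip L' g -> bsupp M f ->
  L1 setT (fun x => pderiv i f x * pderiv i g x).
Proof.
move=> L0 L'0 fL gL fM.
have cf := Lip_continuous fL; have cg := Lip_continuous gL.
apply: (@L1_bounded _ _ (L * L') (M + 1)).
- by apply: measurable_funM; exact: measurable_pderiv.
- by move=> x; rewrite normrM ler_pM// pderiv_le.
- by move=> x Mx; rewrite (bsupp_derive i fM)// mul0r.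
Qed.

Lemma L1_sum A (I : Type) (r : seq I) (F : I -> E -> R) : measurable A ->
  (forall j, L1 A (F j)) -> L1 A (fun x => \sum_(j <- r) F j x) /\
  \int[leb]_(x in A) (\sum_(j <- r) F j x) = \sum_(j <- r) \int[leb]_(x in A) F j x.
Proof.
move=> mA FA; elim: r => [|j r [IH1 IH2]].
  rewrite (_ : (fun x => \sum_(j <- [::]) F j x) = cst 0); last first.
    by apply/funext => x; rewrite big_nil.
  rewrite big_nil; split; first exact: integrable0.
  by rewrite /Rintegral integral0.
rewrite (_ : (fun x => \sum_(k <- j :: r) F k x) =
    (fun x => F j x + \sum_(k <- r) F k x)); last first.
  by apply/funext => x; rewrite big_cons.
split; first exact: L1D.
by rewrite big_cons -IH2 RintegralD//; exact: FA.
Qed.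

(** Writing the gradient part over the whole space gives access to integration by parts, which rests
    on translation invariance. Nothing is added, as the derivatives vanish off the supports. *)
Lemma energy_formE Omega V (xi phi : W1oo_c Omega) : open Omega -> L1loc Omega V ->
  energy_form V xi phi = \sum_i \int[leb]_x (pderiv i xi x * pderiv i phi x) +
    \int[leb]_(x in Omega) (V x * (xi x * phi x)).
Proof.
move=> oO VO; have mO := open_measurable_row oO.
have [L [M [L0 M0 xiL xiM xic]]] := W1oo_cP xi.
have [L' [M' [L'0 M'0 phiL phiM phic]]] := W1oo_cP phi.
have cxi := Lip_continuous xiL; have cphi := Lip_continuous phiL.
have iT i := Lip_pderiv_mul_L1 i L0 L'0 xiL phiL xiM.
have iO i : L1 Omega (fun x => pderiv i xi x * pderiv i phi x) by exact: L1S (iT i).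
have TO i : \int[leb]_x (pderiv i xi x * pderiv i phi x) =
    \int[leb]_(x in Omega) (pderiv i xi x * pderiv i phi x).
  have h x : [set: E] x -> ~ Omega x -> pderiv i xi x * pderiv i phi x = 0.
    move=> _ Ox; rewrite pderiv_tsupport ?mul0r//.
    by apply: contra_not Ox => /xic.2.
  by have [_] := L1_extend measurableT mO (@subsetT _ Omega) h (iO i).
have bP x : `|(xi \* phi) x| <= (`|xi 0| + L * M) * (`|phi 0| + L' * M').
  rewrite /= normrM ler_pM//; first exact: Lip_bounded xiL xiM _.
  exact: Lip_bounded phiL phiM _.
have sP x : (xi \* phi) x != 0 -> tsupport xi x.
  by rewrite /= mulf_eq0 negb_or => /andP[/subset_tsupport].
have mP := measurable_funM (continuous_measurable_row cxi) (continuous_measurable_row cphi).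
have [iV _ _] := L1loc_mul oO VO xic.1 xic.2 mP bP sP.
under eq_bigr do rewrite TO.
have [iS <-] := L1_sum (index_enum 'I_n) mO iO.
rewrite -RintegralD//.
by apply: eq_Rintegral => x _; rewrite /dot_grad mulrA.
Qed.

End energy.

(** * Dense sequences and the inner product of the Hilbert completion *)

Section hilbert.
Context {R : realType}.

Lemma dense_range_cvg (X : normedModType R) (W : Type) (iota : W -> X) :
  dense (range iota) ->
  forall u : X, exists w : nat -> W, iota (w k) @[k --> \oo] --> u.
Proof.
move=> di u.
have /choice[w hw] k : exists w, `|u - iota w| < k.+1%:R^-1.
  have [||x [xu [w _ wx]]] := di (ball u k.+1%:R^-1).
  - by exists u; apply: ballxx; rewrite invr_gt0.
  - exact: ball_open.
  by exists w; rewrite wx; move: xu; rewrite -ball_normE.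
exists w; apply/cvgrPdist_lt => e e0; near=> k.
rewrite (lt_trans (hw k))//; near: k.
exact: near_infty_natSinv_lt (PosNum e0).
Unshelve. all: by end_near. Qed.

Variables (W : lmodType R) (q : W -> W -> R) (H : hilbert_completion q).
Implicit Types (u v w : H).
Local Notation ip := (@hilbert_ip _ _ _ H).
Local Notation incl := (@hilbert_incl _ _ _ H).

Lemma ipDl u v w : ip (u + v) w = ip u w + ip v w.
Proof. by have := hilbert_ip_linear 1 u v w; rewrite scale1r mul1r. Qed.

Lemma ip0l w : ip 0 w = 0.
Proof. by have := ipDl 0 0 w; rewrite addr0 => /eqP; rewrite -subr_eq subrr => /eqP. Qed.

Lemma ipZl a u w : ip (a *: u) w = a * ip u w.
Proof. by have := hilbert_ip_linear a u 0 w; rewrite ip0l !addr0. Qed.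

Lemma ipBl u v w : ip (u - v) w = ip u w - ip v w.
Proof. by rewrite -scaleN1r ipDl ipZl mulN1r. Qed.

Lemma ipBr u v w : ip w (u - v) = ip w u - ip w v.
Proof. by rewrite hilbert_ipC ipBl !(hilbert_ipC w). Qed.

Lemma ipZr a u w : ip w (a *: u) = a * ip w u.
Proof. by rewrite hilbert_ipC ipZl (hilbert_ipC w). Qed.

Lemma hilbert_cauchy_schwarz u v : `|ip u v| <= `|u| * `|v|.
Proof.
have [->|v0] := eqVneq v 0.
  by rewrite hilbert_ipC ip0l !normr0 mulr0.
have vv : 0 < `|v| ^+ 2 by rewrite exprn_gt0// normr_gt0.
have : 0 <= `|u - (ip u v / `|v| ^+ 2) *: v| ^+ 2 by rewrite exprn_ge0.
rewrite hilbert_normE !(ipBl, ipBr, ipZl, ipZr) (hilbert_ipC v u) -!hilbert_normE.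
move=> h; rewrite -ler_sqr ?nnegrE ?mulr_ge0// exprMn real_normK ?num_real//.
rewrite -ler_pdivrMr//; move: h; set a := ip u v; set b := `|v| ^+ 2.
by rewrite divfK ?gt_eqF// subrr subr0 mulrAC -expr2 subr_ge0.
Qed.

Lemma ip_cvg (u_ : nat -> H) u w : u_ k @[k --> \oo] --> u ->
  ip (u_ k) w @[k --> \oo] --> ip u w.
Proof.
move=> uu; apply/cvgrPdist_le => e e0; near=> k.
rewrite -ipBl (le_trans (hilbert_cauchy_schwarz _ _))//.
rewrite (@le_trans _ _ (`|u - u_ k| * (`|w| + 1)))//.
  by rewrite ler_wpM2l// lerDl.
have w0 : 0 < `|w| + 1 by rewrite ltr_wpDl.
rewrite -ler_pdivlMr//; near: k.
by move/cvgrPdist_le : uu; apply; rewrite divr_gt0.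
Unshelve. all: by end_near. Qed.

Lemma norm_hilbert_incl (xi : W) : `|incl xi| = Num.sqrt (q xi xi).
Proof.
have <- := @hilbert_incl_ip _ _ _ H xi xi.
by rewrite -hilbert_normE sqrtr_sqr normr_id.
Qed.

End hilbert.

(** * Weak convergence of gradients *)

Section weak_gradient.
Context {R : realType} {n : nat}.
Local Notation E := 'rV[R]_n.
Local Notation e_ i := (delta_mx 0 i : E).
Local Notation leb := (lebesgue_row n).
Implicit Types (f g h : E -> R) (C L M : R) (i : 'I_n).

Lemma Rintegral_bounded C M f : measurable_fun setT f -> (forall x, `|f x| <= C) ->
  bsupp M f -> `|\int[leb]_x f x| <= \int[leb]_x (C * \1_(ball (0 : E) M) x).
Proof.
move=> mf fC fM; have fi := L1_bounded mf fC fM.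
rewrite (le_trans (le_normr_Rintegral _ _))//.
apply: le_Rintegral => //; first exact: L1_abs.
  have := integrable_ball_cst (n := n) C M.
  by apply: eq_integrable => // x _; rewrite /= mulrC.
by move=> x _; exact: bsupp_bound.
Qed.

(** The constant blows up as t tends to 0, which is harmless because t is fixed before k tends to
    infinity. *)
Lemma Lip_dquot L f i (t : R) : 0 <= L -> Lip L f ->
  Lip (`|t^-1| * (L + L)) (dquot (e_ i) f t).
Proof.
move=> L0 fL x y; rewrite /dquot -mulrBr normrM -mulrA ler_wpM2l//.
have -> : f (t *: e_ i + x) - f x - (f (t *: e_ i + y) - f y) =
   (f (t *: e_ i + x) - f (t *: e_ i + y)) - (f x - f y) by ring.
rewrite (le_trans (ler_normB _ _))// mulrDl lerD//.
by rewrite (le_trans (fL _ _))// opprD addrACA subrr add0r.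
Qed.

(* The derivative of g is replaced by a difference quotient, which is again
   Lipschitz, so that the derivative falling on h can be moved onto it. *)
Lemma weak_pderiv_cvg L L' M (h : nat -> E -> R) (a : nat -> R) g i :
  0 <= L -> 0 <= L' -> 0 <= M -> Lip L' g -> bsupp M g ->
  (forall k, Lip L (h k)) -> (forall k, bsupp M (h k)) ->
  (forall k x, `|h k x| <= a k) -> a k @[k --> \oo] --> 0 ->
  \int[leb]_x (pderiv i g x * pderiv i (h k) x) @[k --> \oo] --> 0.
Proof.
move=> L0 L'0 M0 gL gM hL hM ha a0.
have cg := Lip_continuous gL; have mdg := measurable_pderiv i cg.
have ch k := Lip_continuous (hL k); have mdh k := measurable_pderiv i (ch k).
apply/cvgrPdist_le => e e0.
have Lp : 0 < L + 1 by rewrite ltr_wpDl.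
have eL : 0 < e / 2 / (L + 1) by rewrite !divr_gt0.
have [_ /cvgrPdist_le/(_ _ eL)[m _ /(_ _ (leqnn _))]] := cvg_dquot_L1 i L'0 M0 gL gM.
rewrite /= sub0r normrN; set t := m.+1%:R^-1; set D := dquot (e_ i) g t => hD.
have t1 : `|t| <= 1 by rewrite /t ger0_norm// invf_le1// ler1n.
have DM : bsupp (M + 1) D := bsupp_dquot i gM t1.
have DL : Lip (`|t^-1| * (L' + L')) D := Lip_dquot i t L'0 gL.
have DL0 : 0 <= `|t^-1| * (L' + L') by rewrite mulr_ge0// addr_ge0.
have cD : continuous D := Lip_continuous DL.
have mdD := measurable_pderiv i cD.
have mD := continuous_measurable_row cD.
have M10 : 0 <= M + 1 by rewrite addr_ge0.
have hM1 k : bsupp (M + 1) (h k) by apply: bsupp_le (hM k); rewrite lerDl.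
have dDL1 : L1 setT (pderiv i D).
  apply: (@L1_bounded _ _ (`|t^-1| * (L' + L')) (M + 1 + 1)) => //.
    by move=> x; exact: pderiv_le.
  exact: bsupp_derive.
have DbC := Lip_bounded DL0 M10 DL DM.
have gD1 : L1 setT (fun x => D x - pderiv i g x).
  apply: L1B => //; first exact: Lip_L1 DL DM.
  apply: (@L1_bounded _ _ L' (M + 1)) => //; first by move=> x; exact: pderiv_le.
  exact: bsupp_derive.
(* The error of replacing the derivative of g by D is small in L^1 by the choice of t; it is small
   uniformly in k because the derivatives of the [h k] are bounded by L. *)
have i1 k : `|\int[leb]_x ((D x - pderiv i g x) * pderiv i (h k) x)| <= e / 2.
  have [_ b] := L1_mul_bounded measurableT gD1 (mdh k) (fun x _ => pderiv_le i x L0 (hL k)).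
  rewrite (le_trans b)//.
  rewrite (@le_trans _ _ ((L + 1) * \int[leb]_x `|D x - pderiv i g x|))//.
    by rewrite ler_wpM2r ?lerDl// Rintegral_ge0.
  by rewrite -ler_pdivlMl// mulrC (le_trans (ler_norm _)).
have i2 k : `|\int[leb]_x (D x * pderiv i (h k) x)| <= a k * \int[leb]_x `|pderiv i D x|.
  rewrite (integration_by_parts_row i DL0 L0 M10 DL (hL k) DM (hM1 k)) normrN.
  under eq_Rintegral do rewrite mulrC.
  by have [_] := L1_mul_bounded measurableT dDL1
    (continuous_measurable_row (ch k)) (fun x _ => ha k x).
have iD k : L1 setT (fun x => D x * pderiv i (h k) x).
  have [] // := L1_mul_bounded measurableT (Lip_L1 DL0 M10 DL DM) (mdh k)
    (fun x _ => pderiv_le i x L0 (hL k)).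
have iG k : L1 setT (fun x => (D x - pderiv i g x) * pderiv i (h k) x).
  have [] // := L1_mul_bounded measurableT gD1 (mdh k)
    (fun x _ => pderiv_le i x L0 (hL k)).
have S0 : 0 < \int[leb]_x `|pderiv i D x| + 1 by rewrite ltr_wpDl// Rintegral_ge0.
near=> k; rewrite sub0r normrN.
have iDk := iD k; have iGk := iG k.
have -> : \int[leb]_x (pderiv i g x * pderiv i (h k) x) =
   \int[leb]_x (D x * pderiv i (h k) x) -
   \int[leb]_x ((D x - pderiv i g x) * pderiv i (h k) x).
  by rewrite -RintegralB//; apply: eq_Rintegral => x _; ring.
rewrite (le_trans (ler_normB _ _))// [leRHS]splitr lerD//.
rewrite (le_trans (i2 k))//.
rewrite (@le_trans _ _ (`|a k| * (\int[leb]_x `|pderiv i D x| + 1)))//.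
  by rewrite ler_pM ?Rintegral_ge0 ?ler_norm ?lerDl// (le_trans _ (ha k 0)).
rewrite -ler_pdivlMr//; near: k.
have eS : 0 < e / 2 / (\int[leb]_x `|pderiv i D x| + 1) by rewrite !divr_gt0.
move/cvgrPdist_le : a0 => /(_ _ eS); apply: filterS => k.
by rewrite sub0r normrN.
Unshelve. all: by end_near. Qed.

End weak_gradient.

(** * Energy and distributional solutions *)

Section schroedinger.
Context {R : realType} {n : nat}.
Local Notation E := 'rV[R]_n.
Local Notation leb := (lebesgue_row n).
Implicit Types (A B K U : set E) (C L M : R) (i : 'I_n).

Variables (Omega : set E) (V : E -> R).
Hypotheses (oO : open Omega) (VO : L1loc Omega V).
Variables (H : hilbert_completion (@energy_form R n Omega V)) (J : H -> E -> R).
Hypothesis J_ext : L1loc_extension Omega (hilbert_incl H) (@W1oo_fun R n Omega) J.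
Implicit Types (u : H) (xi phi w : W1oo_c Omega).

Let mO : measurable Omega := open_measurable_row oO.
Local Notation incl := (@hilbert_incl _ _ _ H).
Local Notation ip := (@hilbert_ip _ _ _ H).

Lemma W1oo_continuous (w : W1oo_c Omega) : continuous w.
Proof. by have [L [M [_ _ wL _ _]]] := W1oo_cP w; exact: Lip_continuous wL. Qed.

Lemma W1oo_measurable (w : W1oo_c Omega) A : measurable_fun A w.
Proof.
by apply: measurable_funTS; apply: continuous_measurable_row; exact: W1oo_continuous.
Qed.

Lemma W1oo_L1 (w : W1oo_c Omega) A : measurable A -> L1 A w.
Proof.
move=> mA; have [L [M [L0 M0 wL wM _]]] := W1oo_cP w.
by apply: (L1S measurableT mA) => //; exact: Lip_L1 wL wM.
Qed.

Lemma norm_incl w : `|incl w| = energy_norm V w.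
Proof. exact: norm_hilbert_incl. Qed.

Lemma J_L1loc u : L1loc Omega (J u).
Proof. by have [] := J_ext. Qed.

Lemma J_measurable u A : measurable A -> A `<=` Omega -> measurable_fun A (J u).
Proof. by move=> mA AO; have [mJ _] := J_L1loc u; exact: measurable_funS mJ. Qed.

Lemma ae_subset A B (f g : E -> R) : B `<=` A -> f = g %[ae leb in A] ->
  f = g %[ae leb in B].
Proof. by move=> BA; apply: filterS => x h /BA; exact: h. Qed.

Lemma J_cvg (xi_ : nat -> W1oo_c Omega) u K :
  incl (xi_ k) @[k --> \oo] --> u -> compact K -> K `<=` Omega ->
  \int[leb]_(x in K) `|xi_ k x - J u x| @[k --> \oo] --> 0.
Proof.
move=> xiu cK KO; have mK := compact_measurable_row cK.
have [_ _ Jc Jae] := J_ext.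
have := cvg_comp _ _ xiu (Jc K cK KO u).
apply: cvg_trans; apply: near_eq_cvg; apply: nearW => k /=.
apply: Rintegral_ae_eq => //.
- apply: measurableT_comp => //; apply: measurable_funB; exact: J_measurable.
- apply: measurableT_comp => //; apply: measurable_funB; last exact: J_measurable.
  exact: W1oo_measurable.
- by apply: filterS (ae_subset KO (Jae (xi_ k))) => x h Kx; rewrite h.
Qed.

Lemma mul_cvg (xi_ : nat -> W1oo_c Omega) u (g : E -> R) :
  incl (xi_ k) @[k --> \oo] --> u ->
  continuous g -> compact_support_in Omega g ->
  \int[leb]_(x in Omega) (xi_ k x * g x) @[k --> \oo] -->
  \int[leb]_(x in Omega) (J u x * g x).
Proof.
move=> xiu cg gc; have [C C0 gC] := smooth_bounded cg gc.
have [cK KO] := gc; set K := tsupport g in cK KO.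
have mg := continuous_measurable_row cg.
have mK := compact_measurable_row cK.
have gK x : g x != 0 -> K x by exact: subset_tsupport.
have xiO k : L1loc Omega (xi_ k).
  split; first exact: W1oo_measurable.
  by move=> K' cK' _; apply: W1oo_L1; exact: compact_measurable_row.
have JO := J_L1loc u.
apply/cvgrPdist_le => e e0; near=> k.
have xJO : L1loc Omega (fun x => J u x - xi_ k x).
  split; first by apply: measurable_funB; [exact: JO.1|exact: (xiO k).1].
  move=> K' cK' K'O; apply: L1B; first exact: compact_measurable_row.
    exact: JO.2. exact: (xiO k).2.
have [i1 _ _] := L1loc_mul oO JO cK KO mg gC gK.
have [i2 _ _] := L1loc_mul oO (xiO k) cK KO mg gC gK.
have [i3 _ i3b] := L1loc_mul oO xJO cK KO mg gC gK.
rewrite -RintegralB//.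
under eq_Rintegral do rewrite -mulrBl.
rewrite (le_trans i3b)//.
under eq_Rintegral do rewrite distrC.
rewrite (@le_trans _ _ ((C + 1) * \int[leb]_(x in K) `|xi_ k x - J u x|))//.
  by rewrite ler_wpM2r// ?lerDl// Rintegral_ge0.
rewrite -ler_pdivlMl ?ltr_wpDl//; near: k.
have eC : 0 < (C + 1)^-1 * e by rewrite mulr_gt0// invr_gt0 ltr_wpDl.
move/cvgrPdist_le : (J_cvg xiu cK KO) => /(_ _ eC); apply: filterS => k.
by rewrite sub0r normrN; apply: le_trans; exact: ler_norm.
Unshelve. all: by end_near. Qed.

Lemma Rintegral_subset A B (f : E -> R) : measurable A -> measurable B -> B `<=` A ->
  (forall x, 0 <= f x) -> L1 A f -> \int[leb]_(x in B) f x <= \int[leb]_(x in A) f x.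
Proof.
move=> mA mB BA f0 fA; have fB := L1S mA mB BA fA.
apply: fine_le; [exact: integrable_fin_num|exact: integrable_fin_num|].
apply: ge0_subset_integral => //; last by move=> x _; rewrite lee_fin.
exact: measurable_int fA.
Qed.

Lemma W1oo_fun0 x : (0 : W1oo_c Omega) x = 0.
Proof. by []. Qed.

Lemma W1oo_funB xi phi x : (xi - phi) x = xi x - phi x.
Proof. by []. Qed.

(** Subcriticality at [xi0] = 0, applied to differences, bounds the L^1 norm on the compact closure
    of U by the energy norm. So the sequence is Cauchy also for the norm with the additional L^1(U)
    term. *)
Lemma energy_L1_cvg U (BV : completion (@energy_L1_norm R n Omega V U))
    (xi_ : nat -> W1oo_c Omega) u :
  L1_subcritical Omega V -> open U -> compactly_contained U Omega ->
  incl (xi_ k) @[k --> \oo] --> u ->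
  cvg (@completion_incl _ _ _ BV (xi_ k) @[k --> \oo]).
Proof.
move=> [_ sub] oU [cK KO] xiu; apply/cauchy_cvgP/cauchy_exP => e e0.
have mU := open_measurable_row oU.
have mK := compact_measurable_row cK.
have e20 : 0 < e / 2 by rewrite divr_gt0.
have [d d0 hd] := sub _ cK KO 0 _ e20.
have d20 : 0 < Num.min d (e / 2) / 2 by rewrite divr_gt0// lt_min d0.
move/cvgrPdist_lt : xiu => /(_ _ d20)[N _ hN].
exists (completion_incl BV (xi_ N)); exists N => // k /= Nk.
have h : energy_norm V (xi_ N - xi_ k) < Num.min d (e / 2).
  rewrite -norm_incl linearB -(subrKA u) (le_lt_trans (ler_normD _ _))//.
  rewrite [ltRHS]splitr ltrD//; last exact: hN.
  by rewrite distrC; apply: hN => /=.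
move: h; rewrite lt_min => /andP[h1 h2].
rewrite -ball_normE /= -linearB completion_norm /energy_L1_norm [ltRHS]splitr ltrD//.
have := hd (xi_ N - xi_ k); rewrite subr0 => /(_ h1); apply: le_lt_trans.
under [leRHS]eq_Rintegral do rewrite W1oo_fun0 subr0.
apply: Rintegral_subset => //; first exact: subset_closure.
exact/L1_abs/W1oo_L1.
Qed.

(** Let w be the limit of the [xi_] in B_V(Omega; U). Continuity of [VV] gives the convergence of V
    [xi_] to [VV w] in the dual, balancedness identifies [VV w] with V [JU w], and [JU w] equals
    [J u] almost everywhere on U. *)
Lemma balanced_ball (xi_ : nat -> W1oo_c Omega) u B U :
  L1_subcritical Omega V -> incl (xi_ k) @[k --> \oo] --> u ->
  measurable B -> open U -> compactly_contained U Omega -> B `<=` U ->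
  balanced_on Omega V B U ->
  L1 B (V \* J u) /\ forall phi : C2c B,
   \int[leb]_(x in B) (V x * xi_ k x * phi x) @[k --> \oo] -->
   \int[leb]_(x in B) (V x * J u x * phi x).
Proof.
move=> sub xiu mB oU UO BU [BV [XB [JU [VV [[JU1 JUlin JUc JUae] [VVlin VVc VVe] bal]]]]].
have mU := open_measurable_row oU; have [cK KO] := UO.
have mK := compact_measurable_row cK.
have UK : U `<=` closure U by exact: subset_closure.
have UsO : U `<=` Omega by exact: subset_trans KO.
have BO : B `<=` Omega by exact: subset_trans UsO.
have /cvg_ex[w yw] := energy_L1_cvg (BV := BV) sub oU UO xiu.
have c1 : \int[leb]_(x in U) `|xi_ k x - JU w x| @[k --> \oo] --> 0.
  have := cvg_comp _ _ yw (JUc w).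
  apply: cvg_trans; apply: near_eq_cvg; apply: nearW => k /=.
  apply: Rintegral_ae_eq => //.
  - by apply: measurableT_comp => //; apply: measurable_funB;
      apply: L1_measurable; exact: JU1.
  - apply: measurableT_comp => //; apply: measurable_funB.
      exact: W1oo_measurable.
    by apply: L1_measurable; exact: JU1.
  - by apply: filterS (JUae (xi_ k)) => x h Ux; rewrite h.
have c2 := J_cvg xiu cK KO.
have JuK : L1 (closure U) (J u) by exact: (J_L1loc u).2.
have JuU : L1 U (J u) by exact: L1S JuK.
have JUw := JU1 w.
(* Both functions are limits of the [xi_] in L^1(U). For each k, the triangle inequality bounds the
   integral by a sum that tends to 0; the signs are reversed because [cvgn_le] passes upper bounds
   to the limit. *)
have JJ : \int[leb]_(x in U) `|JU w x - J u x| = 0.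
  apply/eqP; rewrite eq_le Rintegral_ge0// andbT.
  have := cvgn_le (M := - \int[leb]_(x in U) `|JU w x - J u x|) (cvgN (cvgD c1 c2)).
  rewrite addr0 oppr0 oppr_ge0; apply => k; rewrite lerN2.
  have xiU := W1oo_L1 (xi_ k) mU; have xiK := W1oo_L1 (xi_ k) mK.
  have i1 := L1_abs (L1B mU xiU JUw); have i2 := L1_abs (L1B mU xiU JuU).
  rewrite (@le_trans _ _ (\int[leb]_(x in U) `|xi_ k x - JU w x| +
      \int[leb]_(x in U) `|xi_ k x - J u x|))//; last first.
    by rewrite lerD2l; apply: Rintegral_subset => //; exact/L1_abs/L1B.
  rewrite -RintegralD//; apply: le_Rintegral => //.
  - exact/L1_abs/L1B.
  - exact: L1D.
  - move=> x _; rewrite -(subrKA (xi_ k x)) (le_trans (ler_normD _ _))//.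
    by rewrite distrC.
have JuE : JU w = J u %[ae leb in U].
  have := Rintegral_norm0_ae mU (L1B mU JUw JuU) JJ.
  by apply: filterS => x h /h /eqP; rewrite subr_eq0 => /eqP.
have JuB := ae_subset BU JuE.
have mV : measurable_fun B V by exact: measurable_funS VO.1.
have mJB : measurable_fun B (J u) by exact: J_measurable.
have mJUB : measurable_fun B (JU w) by apply: measurable_funS (L1_measurable JUw).
have [bw1 bw2] := bal w.
split.
  apply: L1_ae_eq mB bw1 _ _; first exact: measurable_funM.
  by apply: filterS JuB => x h Bx /=; rewrite h.
move=> phi; have [[cphi _] _] : isCk 2 phi /\ compact_support_in B° phi
    by exact/asboolP/(valP phi).
have mphi : measurable_fun B phi by apply: measurable_funTS; exact: continuous_measurable_row.
have -> : \int[leb]_(x in B) (V x * J u x * phi x) = VV w (completion_incl XB phi).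
  rewrite bw2; apply: Rintegral_ae_eq => //.
  - by apply: measurable_funM => //; exact: measurable_funM.
  - by apply: measurable_funM => //; exact: measurable_funM.
  - by apply: filterS JuB => x h Bx /=; rewrite h.
under eq_fun do rewrite -VVe.
apply/cvgrPdist_le => e e0.
have p0 : 0 < `|completion_incl XB phi| + 1 by rewrite ltr_wpDl.
have e1 : 0 < e / (`|completion_incl XB phi| + 1) by rewrite divr_gt0.
have hV : \forall k \near \oo, forall psi,
    `|VV (completion_incl BV (xi_ k)) psi - VV w psi| <=
      e / (`|completion_incl XB phi| + 1) * `|psi| := yw _ (VVc w _ e1).
apply: filterS hV => k /(_ (completion_incl XB phi)).
by rewrite distrC => h; rewrite (le_trans h)// mulrAC ler_pdivrMr// ler_wpM2l ?lerDl// ltW.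
Qed.
Lemma L1_setU A B (f : E -> R) : measurable A -> measurable B ->
  L1 A f -> L1 B f -> L1 (A `|` B) f.
Proof.
move=> mA mB fA fB; have mAB : measurable (A `|` B) by exact: measurableU.
have mBA : measurable (B `\` A) by exact: measurableD.
have fBA : L1 (B `\` A) f by apply: L1S fB => // x [].
apply/(integrable_mkcond _ mAB).
move/(integrable_mkcond _ mA) : fA => fA; move/(integrable_mkcond _ mBA) : fBA => fBA.
have := integrableD measurableT fA fBA.
rewrite (_ : (fun x => _) = (EFin \o f) \_ (A `|` B))//.
apply/funext => x /=; rewrite !patchE in_setU in_setD.
have [xA|xA] /= := boolP (x \in A); first by rewrite andbF adde0.
by rewrite andbT add0e.
Qed.

Lemma cvg_sumr (I : Type) (r : seq I) (a : I -> nat -> R) (l : I -> R) :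
  (forall j, a j k @[k --> \oo] --> l j) ->
  (\sum_(j <- r) a j k) @[k --> \oo] --> \sum_(j <- r) l j.
Proof.
move=> al; elim: r => [|j r IH].
  by rewrite big_nil; under eq_fun do rewrite big_nil; exact: cvg_cst.
rewrite big_cons; under eq_fun do rewrite big_cons; exact: cvgD.
Qed.

(** Comparison of Euclidean balls with balls of the sup norm. The factor 2 passes from a closed to
    an open ball; the crude n + 1 works as n/(n+1)^2 is at most 1, and it is nonzero even for n =
    0. *)
Lemma euclidean_ball_bounds (x : E) (r : R) : 0 < r ->
  [/\ measurable (euclidean_closed_ball x r),
      euclidean_closed_ball x r `<=` ball x (r * 2) &
      ball x (r / n.+1%:R) `<=` euclidean_closed_ball x r].
Proof.
move=> r0; split.
- pose F (y : E) := \sum_i (y 0 i - x 0 i) ^+ 2.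
  have mF : measurable_fun setT F.
    apply: measurable_sum => i; apply: measurable_funX; apply: measurable_funB => //.
    exact: measurable_row_coor.
  rewrite (_ : euclidean_closed_ball _ _ = setT `&` F @^-1` `]-oo, r ^+ 2]%classic).
    exact: mF.
  by rewrite setTI; apply/seteqP; split => y /=; rewrite /euclidean_closed_ball /= in_itv.
- move=> y yB; split; first by rewrite mulr_gt0.
  move=> i j; rewrite ord1 /ball/=.
  rewrite (@le_lt_trans _ _ r)// ?ltr_pMr ?ltr1n//.
  rewrite -ler_sqr ?nnegrE ?normr_ge0 ?(ltW r0)// real_normK ?num_real//.
  rewrite (le_trans _ yB)// (bigD1 j)//= -sqrrN opprB lerDl sumr_ge0// => *.
  exact: sqr_ge0.
- move=> y [_ xy]; rewrite /euclidean_closed_ball /=.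
  have h i : (y 0 i - x 0 i) ^+ 2 <= (r / n.+1%:R) ^+ 2.
    have := xy 0 i; rewrite /ball/= distrC => /ltW h.
    by rewrite -(real_normK (num_real (y 0 i - x 0 i))) ler_sqr ?nnegrE ?divr_ge0// ltW.
  rewrite (@le_trans _ _ (\sum_(i < n) (r / n.+1%:R) ^+ 2))//; first exact: ler_sum.
  rewrite sumr_const card_ord exprMn -mulrnAr ler_piMr ?sqr_ge0//.
  rewrite -mulr_natr exprVn mulrC ler_pdivrMr ?exprn_gt0// mul1r expr2.
  rewrite (@le_trans _ _ n.+1%:R)// ?ler_nat// -[leLHS]mulr1 ler_wpM2l// ler1n//.
Qed.

(** Here B is a Euclidean ball inside Omega and r the radius of a sup-norm ball inside B. A function
    supported in the closed ball of radius r/2 has compact support in the interior of B, hence is an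
    admissible test function for the dual of C^2_c(B). *)
Lemma balanced_local (xi_ : nat -> W1oo_c Omega) u (x : E) :
  L1_subcritical Omega V -> balanced Omega V ->
  incl (xi_ k) @[k --> \oo] --> u -> Omega x ->
  exists (r : R) B, [/\ 0 < r, measurable B, B `<=` Omega, ball x r `<=` B /\ L1 B (V \* J u) &
   forall f : E -> R, isCk 2 f -> (forall y, f y != 0 -> `|y - x| <= r / 2) ->
     \int[leb]_(x in B) (V x * xi_ k x * f x) @[k --> \oo] -->
     \int[leb]_(x in B) (V x * J u x * f x)].
Proof.
move=> sub [_ bal] xiu Ox.
have /nbhs_ballP[e /= e0 xe] := oO Ox.
have e20 : 0 < e / 2 by rewrite divr_gt0.
have [mB B1 B2] := euclidean_ball_bounds x e20.
have BO : euclidean_closed_ball x (e / 2) `<=` Omega.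
  by apply: subset_trans B1 _; rewrite divfK.
have [U [oU UO BU bU]] := bal _ _ e20 BO.
have [h1 h2] := balanced_ball sub xiu mB oU UO BU bU.
pose r := e / 2 / n.+1%:R; have r0 : 0 < r by rewrite divr_gt0.
exists r, (euclidean_closed_ball x (e / 2)); split => //.
move=> f Cf fx.
have fc : compact_support_in (euclidean_closed_ball x (e / 2))° f.
  apply: compact_support_in_subset (@compact_closed_ball _ _ x (r / 2)) _ fx.
  move=> y /= yx; rewrite /interior /=.
  have : nbhs y (ball x r).
    apply: open_nbhs_nbhs; split; first exact: ball_open.
    rewrite -ball_normE /= distrC (le_lt_trans yx)// ltr_pdivrMr// ltr_pMr//.
    by rewrite ltr1n.
  exact: filterS.
have fP : f \in C2_c (euclidean_closed_ball x (e / 2)) by apply/asboolP.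
exact: (h2 (MkC2c fP)).
Qed.

(** Balancedness gives integrability near each point, and finitely many of these neighbourhoods
    cover a compact set. *)
Lemma VJ_L1loc u : L1_subcritical Omega V -> balanced Omega V ->
  L1loc Omega (V \* J u).
Proof.
move=> sub bal; split.
  by apply: measurable_funM; [exact: VO.1|exact: (J_L1loc u).1].
move=> K cK KO.
have [xi_ xiu] := dense_range_cvg (@hilbert_dense _ _ _ H) u.
have /choice[rB hrB] x : exists p : R * set E, Omega x ->
    [/\ 0 < p.1, measurable p.2, ball x p.1 `<=` p.2 & L1 p.2 (V \* J u)].
  have [Ox|nOx] := pselect (Omega x); last by exists (0, set0).
  have [r [B [r0 mB _ [xB LB] _]]] := balanced_local sub bal xiu Ox.
  by exists (r, B).
have mK := compact_measurable_row cK.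
have := cK; rewrite compact_cover => /(_ _ K (fun x => ball x (rB x).1)).
case => [x Kx|x Kx|D DK KD]; first exact: ball_open.
  by exists x => //; apply: ballxx; have [] := hrB _ (KO _ Kx).
have [T [mT LT KT]] : exists T, [/\ measurable T, L1 T (V \* J u) &
    forall y, (exists2 x, x \in finmap.enum_fset D & ball x (rB x).1 y) -> T y].
  have : forall x, x \in finmap.enum_fset D -> Omega x.
    by move=> x xD; apply: KO; have := DK x xD; rewrite inE.
  elim: (finmap.enum_fset D) => [_|x s IH sO].
    exists set0; split => //; last by move=> y [].
    exact: integrable_set0.
  have [|T [mT LT hT]] := IH; first by move=> y ys; apply: sO; rewrite inE ys orbT.
  have [_ mB xB LB] := hrB _ (sO _ (mem_head _ _)).
  exists ((rB x).2 `|` T); split; [exact: measurableU|exact: L1_setU|].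
  move=> y [z + zy]; rewrite inE => /orP[/eqP zx|zs].
    by left; apply: xB; rewrite -zx.
  by right; apply: hT; exists z.
apply: (L1S mT mK _ LT) => y /KD[x /= xD xy]; apply: KT; exists x => //.
Qed.

(** The convergence is additive in f and known for f supported near a point, so
    [smooth_localization] applies. Additivity of the integrals needs the integrability facts [iJ]
    and [iX]. *)
Lemma V_mul_cvg (xi_ : nat -> W1oo_c Omega) u (f : E -> R) :
  L1_subcritical Omega V -> balanced Omega V ->
  incl (xi_ k) @[k --> \oo] --> u ->
  smooth f -> compact_support_in Omega f ->
  \int[leb]_(x in Omega) (V x * (xi_ k x * f x)) @[k --> \oo] -->
  \int[leb]_(x in Omega) (V x * J u x * f x).
Proof.
move=> sub bal xiu.
have VJ := VJ_L1loc u sub bal.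
have iJ g : smooth g -> compact_support_in Omega g ->
    L1 Omega (fun x => V x * J u x * g x).
  move=> sg gc; have cg := isCk_continuous (sg 0%N).
  have [C C0 gC] := smooth_bounded cg gc.
  have [|//] := L1loc_mul oO VJ gc.1 gc.2 (continuous_measurable_row cg) gC.
  exact: subset_tsupport.
have iX g k : smooth g -> compact_support_in Omega g ->
    L1 Omega (fun x => V x * (xi_ k x * g x)).
  move=> sg gc; have cg := isCk_continuous (sg 0%N).
  have cx := @W1oo_continuous (xi_ k).
  have cgx : continuous (g \* xi_ k) by move=> x; exact: cvgM (cg x) (cx x).
  have gxc : compact_support_in Omega (g \* xi_ k) by exact: compact_support_inM.
  have [C C0 gC] := smooth_bounded cgx gxc.
  have [|+ _ _] := L1loc_mul oO VO gxc.1 gxc.2 (continuous_measurable_row cgx) gC.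
    exact: subset_tsupport.
  by congr (L1 _ _); apply/funext => x /=; rewrite (mulrC (g x)).
move: f; apply: smooth_localization => //.
- rewrite (_ : (fun k => _) = cst (\int[leb]_(x in Omega) (V x * J u x * 0))).
    exact: cvg_cst.
  by apply/funext => k; apply: eq_Rintegral => x _; rewrite !mulr0.
- move=> f g sf fc sg gc hf hg.
  have -> : \int[leb]_(x in Omega) (V x * J u x * (f + g) x) =
      \int[leb]_(x in Omega) (V x * J u x * f x) + \int[leb]_(x in Omega) (V x * J u x * g x).
    rewrite -RintegralD//; [|exact: iJ|exact: iJ].
    by apply: eq_Rintegral => x _; rewrite -mulrDr.
  rewrite (_ : (fun k => _) = (fun k => \int[leb]_(x in Omega) (V x * (xi_ k x * f x)) +
      \int[leb]_(x in Omega) (V x * (xi_ k x * g x)))); first exact: cvgD.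
  apply/funext => k; rewrite -RintegralD//; [|exact: iX|exact: iX].
  by apply: eq_Rintegral => x _; rewrite -!mulrDr.
- move=> x Ox; have [r [B [r0 mB BO [xB LB] hB]]] := balanced_local sub bal xiu Ox.
  exists (r / 2); first by rewrite divr_gt0.
  move=> f sf fc fx.
  have f0 y : Omega y -> ~ B y -> f y = 0.
    move=> _ By; apply/eqP; apply: contra_notT By => /fx yx; apply: xB.
    rewrite -ball_normE /= distrC (lt_trans yx)// ltr_pdivrMr// ltr_pMr//.
    by rewrite ltr1n.
  have [||_ ->] := L1_extend (f := fun x => V x * J u x * f x) mO mB BO.
  - by move=> y Oy By; rewrite f0// mulr0.
  - by apply: (L1S mO) => //; exact: iJ.
  rewrite (_ : (fun k => _) = (fun k => \int[leb]_(x in B) (V x * xi_ k x * f x))).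
    by apply: hB => // y /fx/ltW.
  apply/funext => k.
  have [||_ ->] := L1_extend (f := fun x => V x * (xi_ k x * f x)) mO mB BO.
  - by move=> y Oy By; rewrite f0// !mulr0.
  - by apply: (L1S mO) => //; exact: iX.
  by apply: eq_Rintegral => y _; rewrite mulrA.
Qed.
Lemma smooth_pderiv (f : E -> R) i : smooth f -> smooth (pderiv i f).
Proof. by move=> sf k; exact/isCk_pderiv/sf. Qed.

Lemma grad_by_parts (xi : W1oo_c Omega) (f : E -> R) i :
  smooth f -> compact_support_in Omega f ->
  \int[leb]_x (pderiv i xi x * pderiv i f x) =
  - \int[leb]_(x in Omega) (xi x * pderiv i (pderiv i f) x).
Proof.
move=> sf fc; have [L [M [L0 M0 xiL xiM _]]] := W1oo_cP xi.
have dfc := compact_support_pderiv i fc.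
have [M' M'0 dfM] := compact_bsupp dfc.1.
have [L' L'0 dfL] := C1_Lip (smooth_pderiv i sf 1%N) dfM.
pose N := Num.max M M'.
have N0 : 0 <= N by rewrite le_max M0.
have xiN : bsupp N xi by apply: bsupp_le xiM; rewrite le_max lexx.
have dfN : bsupp N (pderiv i f) by apply: bsupp_le dfM; rewrite le_max lexx orbT.
have -> : \int[leb]_x (pderiv i xi x * pderiv i f x) =
    \int[leb]_x (pderiv i f x * pderiv i xi x).
  by apply: eq_Rintegral => x _; rewrite mulrC.
rewrite (integration_by_parts_row i L'0 L0 N0 dfL xiL dfN xiN); congr (- _).
have ddfc := compact_support_pderiv i dfc.
have z x : [set: E] x -> ~ Omega x -> xi x * pderiv i (pderiv i f) x = 0.
  move=> _ Ox; rewrite (tsupport_out (f := pderiv i (pderiv i f))) ?mulr0//.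
  by apply: contra_not Ox => /ddfc.2.
have cddf := isCk_continuous (smooth_pderiv i (smooth_pderiv i sf) 0%N).
have [C C0 hC] := smooth_bounded cddf ddfc.
have [i1 _] := L1_mul_bounded mO (W1oo_L1 xi mO)
  (measurable_funTS (continuous_measurable_row cddf)) (fun x _ => hC x).
by have [_] := L1_extend measurableT mO (@subsetT _ Omega) z i1.
Qed.

(** For the Lipschitz approximants of u, the formula is integration by parts, with both derivatives
    on phi; each of its terms then passes to the limit, and limits are unique. *)
Lemma energy_smooth u (phi : W1oo_c Omega) :
  L1_subcritical Omega V -> balanced Omega V -> smooth phi ->
  ip u (incl phi) =
  \int[leb]_(x in Omega) (J u x * (- laplacian phi x + V x * phi x)).
Proof.
move=> sub bal sphi.
have [_ [_ [_ _ _ _ phic]]] := W1oo_cP phi.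
have [xi_ xiu] := dense_range_cvg (@hilbert_dense _ _ _ H) u.
have ddc i := compact_support_pderiv i (compact_support_pderiv i phic).
have cdd i := isCk_continuous (smooth_pderiv i (smooth_pderiv i sphi) 0%N).
have cphi := isCk_continuous (sphi 0%N).
have VJ := VJ_L1loc u sub bal.
have JO := J_L1loc u.
have iJ i : L1 Omega (fun x => J u x * pderiv i (pderiv i phi) x).
  have [C C0 hC] := smooth_bounded (cdd i) (ddc i).
  have [|//] := L1loc_mul oO JO (ddc i).1 (ddc i).2 (continuous_measurable_row (cdd i)) hC.
  exact: subset_tsupport.
have iV : L1 Omega (fun x => V x * J u x * phi x).
  have [C C0 hC] := smooth_bounded cphi phic.
  have [|//] := L1loc_mul oO VJ phic.1 phic.2 (continuous_measurable_row cphi) hC.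
  exact: subset_tsupport.
have [iS SE] := L1_sum (index_enum 'I_n) mO iJ.
have -> : \int[leb]_(x in Omega) (J u x * (- laplacian phi x + V x * phi x)) =
    - (\sum_i \int[leb]_(x in Omega) (J u x * pderiv i (pderiv i phi) x)) +
    \int[leb]_(x in Omega) (V x * J u x * phi x).
  rewrite addrC -SE -RintegralB//; apply: eq_Rintegral => x _.
  by rewrite /laplacian -mulr_sumr; ring.
rewrite -(cvg_lim (@Rhausdorff R) (ip_cvg (w := incl phi) xiu)).
apply: (cvg_lim (@Rhausdorff R)).
rewrite (_ : (fun k => _) = fun k =>
    - (\sum_i \int[leb]_(x in Omega) (xi_ k x * pderiv i (pderiv i phi) x)) +
    \int[leb]_(x in Omega) (V x * (xi_ k x * phi x))); last first.
  apply/funext => k; rewrite hilbert_incl_ip energy_formE//; congr (_ + _).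
  by rewrite -sumrN; apply: eq_bigr => i _; exact: grad_by_parts.
apply: cvgD; last exact: V_mul_cvg.
apply: cvgN; apply: cvg_sumr => i; exact: mul_cvg.
Qed.

(** The differences [h k] tend to 0 uniformly, with a common Lipschitz constant and a common compact
    support. Their images in the Hilbert space are therefore bounded and tend to 0 against every
    Lipschitz function, hence weakly. *)
Lemma smooth_test_approximation u (phi : W1oo_c Omega) :
  exists zeta : nat -> W1oo_c Omega,
  [/\ forall k, smooth (zeta k), ip u (incl (zeta k)) @[k --> \oo] --> ip u (incl phi) &
   forall v : E -> R, L1loc Omega v ->
   \int[leb]_(x in Omega) (v x * zeta k x) @[k --> \oo] -->
   \int[leb]_(x in Omega) (v x * phi x)].
Proof.
have [L [_ [L0 _ phiL _ phic]]] := W1oo_cP phi.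
have [K' [z [cK' K'O hz]]] := smooth_approximation L0 phiL phic.1 oO phic.2
  (@subset_tsupport _ _ _).
have /choice[zeta zE] k : exists w : W1oo_c Omega, W1oo_fun w = z k.
  have [_ zL _ zK'] := hz k.
  by apply: (W1oo_of zL); exact: compact_support_in_subset cK' K'O zK'.
pose h k : W1oo_c Omega := zeta k - phi.
have hE k x : h k x = z k x - phi x by rewrite /h W1oo_funB zE.
pose K := K' `|` tsupport phi.
have cK : compact K by apply: compactU => //; exact: phic.1.
have KO : K `<=` Omega by move=> x [/K'O|/phic.2].
have hK k x : h k x != 0 -> K x.
  have [_ _ _ zK'] := hz k.
  rewrite hE => hx; have [phi0|/subset_tsupport] := eqVneq (phi x) 0; last by right.
  by left; apply: zK'; rewrite phi0 subr0 in hx.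
pose a k : R := L * k.+1%:R^-1.
have a0 : a k @[k --> \oo] --> 0.
  rewrite -[X in _ --> X](mulr0 L); apply: cvgM; first exact: cvg_cst.
  exact: cvg_harmonic.
have ha k x : `|h k x| <= a k by have [_ _ + _] := hz k; rewrite hE; exact.
have aL k : a k <= L by rewrite /a ler_piMr// invf_le1// ler1n.
have hL k : Lip (L + L) (h k).
  have [_ zL _ _] := hz k; move=> x y; rewrite !hE.
  have -> : z k x - phi x - (z k y - phi y) = (z k x - z k y) - (phi x - phi y) by ring.
  by rewrite (le_trans (ler_normB _ _))// mulrDl lerD.
have LL0 : 0 <= L + L by rewrite addr_ge0.
have [M M0 hM] : exists2 M, 0 <= M & forall k, bsupp M (h k).
  have [M M0 hM] := compact_in_ball cK; exists M => // k x Mx.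
  apply/eqP; rewrite -[_ == _]negbK; apply/negP => /hK/hM.
  by rewrite ltNge Mx.
have mh k : measurable_fun setT (h k) by exact: W1oo_measurable.
(* Used twice: with v = V and g a Lipschitz function for the potential part of the form, and with g
   = 1 for the last claim. *)
have vh (v g : E -> R) (C : R) : L1loc Omega v -> continuous g ->
    (forall x, `|g x| <= C) -> 0 <= C ->
    \int[leb]_(x in Omega) (v x * (g x * h k x)) @[k --> \oo] --> 0.
  move=> vO cg gC C0.
  have b k : `|\int[leb]_(x in Omega) (v x * (g x * h k x))| <=
      a k * (C * \int[leb]_(x in K) `|v x|).
    have gb x : `|(g \* h k) x| <= a k * C.
      by rewrite normrM [leRHS]mulrC; apply: ler_pM.
    have gK x : (g \* h k) x != 0 -> K x.
      by rewrite /= mulf_eq0 negb_or => /andP[_ /hK].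
    have mgh := measurable_funM (continuous_measurable_row cg) (mh k).
    by have [_ _] := L1loc_mul oO vO cK KO mgh gb gK; rewrite mulrA.
  apply: norm_cvg0.
  apply: (@squeeze_cvgr _ _ _ _ (cst 0) (fun k => a k * (C * \int[leb]_(x in K) `|v x|))).
  - by apply: nearW => k; rewrite /= normr_ge0 b.
  - exact: cvg_cst.
  - rewrite -[X in _ --> X](mul0r (C * \int[leb]_(x in K) `|v x|)).
    exact: cvgM a0 (cvg_cst _).
have hphi (psi : W1oo_c Omega) : ip (incl psi) (incl (h k)) @[k --> \oo] --> 0.
  have [L1' [M1 [L10 M10 psiL psiM psic]]] := W1oo_cP psi.
  pose N := Num.max M M1.
  have N0 : 0 <= N by rewrite le_max M0.
  have psiN : bsupp N psi by apply: bsupp_le psiM; rewrite le_max lexx orbT.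
  have hN k : bsupp N (h k) by apply: bsupp_le (hM k); rewrite le_max lexx.
  rewrite (_ : (fun k => _) = fun k =>
    \sum_i \int[leb]_x (pderiv i psi x * pderiv i (h k) x) +
    \int[leb]_(x in Omega) (V x * (psi x * h k x))); last first.
    by apply/funext => k; rewrite hilbert_incl_ip energy_formE.
  rewrite -[X in _ --> X]addr0; apply: cvgD.
    rewrite [X in _ --> X](_ : 0 = \sum_(i < n) 0); last by rewrite big1.
    apply: cvg_sumr => i.
    exact: (weak_pderiv_cvg i LL0 L10 N0 psiL psiN hL hN ha a0).
  have cpsi := Lip_continuous psiL.
  have [C C0 psiC] := continuous_bounded cpsi psiM.
  exact: vh VO cpsi psiC C0.
(* The gradients are bounded by L + L and the functions by L, on supports independent of k. *)
have [D D0 hD] : exists2 D, 0 < D & forall k, `|incl (h k)| <= D.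
  pose S := \sum_(i < n) \int[leb]_x ((L + L) * (L + L) * \1_(ball (0 : E) (M + 1)) x) +
    L * L * \int[leb]_(x in K) `|V x|.
  have hS k : `|incl (h k)| ^+ 2 <= S.
    rewrite hilbert_normE hilbert_incl_ip energy_formE//; apply: lerD.
      apply: ler_sum => i _; rewrite (le_trans (ler_norm _))//.
      have ch := Lip_continuous (hL k).
      apply: Rintegral_bounded.
      - by apply: measurable_funM; exact: measurable_pderiv.
      - by move=> x; rewrite normrM ler_pM// pderiv_le.
      - by move=> x Mx; rewrite (bsupp_derive i (hM k))// mul0r.
    have gb x : `|(h k \* h k) x| <= L * L.
      by rewrite /= normrM ler_pM// (le_trans (ha _ _)).
    have gK x : (h k \* h k) x != 0 -> K x.
      by rewrite /= mulf_eq0 negb_or => /andP[_ /hK].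
    have [_ _ b] := L1loc_mul oO VO cK KO (measurable_funM (mh k) (mh k)) gb gK.
    by rewrite (le_trans (ler_norm _)).
  have S0 : 0 <= S by rewrite (le_trans _ (hS 0%N))// exprn_ge0.
  (* If t^2 is at most S, then t is at most S + 1; this bound is positive and avoids a square
     root. *)
  exists (S + 1); first by rewrite ltr_wpDl.
  by move=> k; have := hS k; set t := `|_|; nra.
exists zeta; split.
- by move=> k; rewrite zE; have [] := hz k.
- apply/subr_cvg0; rewrite (_ : (fun k => _) = fun k => ip u (incl (h k))); last first.
    by apply/funext => k /=; rewrite /h linearB ipBr.
  apply/cvgrPdist_le => e e0.
  (* Replace u by a fixed Lipschitz [psi_ m]: the error is controlled by Cauchy-Schwarz and the
     bound [D], uniformly in k. *)
  have [psi_ psiu] := dense_range_cvg (@hilbert_dense _ _ _ H) u.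
  have eD : 0 < e / 2 / D by rewrite !divr_gt0.
  move/cvgrPdist_le : psiu => /(_ _ eD)[m _ /(_ _ (leqnn _)) um].
  have e20 : 0 < e / 2 by rewrite divr_gt0.
  move/cvgrPdist_le : (hphi (psi_ m)) => /(_ _ e20); apply: filterS => k.
  rewrite !sub0r !normrN => hk.
  rewrite -(subrK (incl (psi_ m)) u) ipDl (le_trans (ler_normD _ _))//.
  rewrite [leRHS]splitr lerD// (le_trans (hilbert_cauchy_schwarz _ _))//.
  rewrite (@le_trans _ _ (`|u - incl (psi_ m)| * D))//; first by rewrite ler_wpM2l.
  by rewrite -ler_pdivlMr.
- move=> v vO.
  have iv (w : W1oo_c Omega) : L1 Omega (fun x => v x * w x).
    have [_ [M1 [_ _ _ wM wc]]] := W1oo_cP w.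
    have cw := @W1oo_continuous w; have [C C0 hC] := continuous_bounded cw wM.
    have [|//] := L1loc_mul oO vO wc.1 wc.2 (continuous_measurable_row cw) hC.
    exact: subset_tsupport.
  apply/subr_cvg0; rewrite (_ : (fun k => _) = fun k => \int[leb]_(x in Omega) (v x * (1 * h k x))).
    apply: (vh v (fun=> 1) 1) => //; first exact: cst_continuous.
    by move=> x; rewrite normr1.
  apply/funext => k; rewrite -RintegralB//; [|exact: iv|exact: iv].
  by apply: eq_Rintegral => x _; rewrite mul1r hE zE mulrBr.
Qed.

End schroedinger.

Theorem proposition6p7 (R : realType) (N : nat) (N_ge1 : (1 <= N)%N)
  (Omega : set 'rV[R]_N) (Omega_domain : domain Omega)
  (V : 'rV[R]_N -> R) (V_L1loc : L1loc Omega V)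
  (V_balanced : balanced Omega V) (V_subcritical : L1_subcritical Omega V)
  (H : hilbert_completion (@energy_form R N Omega V))
  (J : H -> 'rV[R]_N -> R)
  (J_extension : L1loc_extension Omega (hilbert_incl H) (@W1oo_fun R N Omega) J)
  (f : 'rV[R]_N -> R) (f_L1loc : L1loc Omega f) (u : H) :
  energy_solution f u <-> distributional_solution Omega V f (J u).
Proof.
have [oO _ _] := Omega_domain.
have key xi := energy_smooth (phi := xi) oO V_L1loc J_extension u V_subcritical
  V_balanced.
split=> [uf|[_ _ uf] xi].
  split; [exact: J_L1loc J_extension u|exact: VJ_L1loc|].
  (* A smooth function with compact support is Lipschitz, hence an admissible test function for
     energy solutions. *)
  move=> xi sxi xic; have [M _ xiM] := compact_bsupp xic.1.
  have [L _ xiL] := C1_Lip (sxi 1%N) xiM.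
  by have [w wE] := W1oo_of xiL xic; subst xi; rewrite -key// uf.
have [zeta [szeta uz zf]] := smooth_test_approximation oO V_L1loc u xi.
rewrite -(cvg_lim (@Rhausdorff R) uz); apply: (cvg_lim (@Rhausdorff R)).
rewrite (_ : (fun k => _) =
    fun k => \int[lebesgue_row N]_(x in Omega) (f x * zeta k x)).
  exact: zf.
apply/funext => k; rewrite key//; apply: uf => //.
by have [_ [_ [_ _ _ _ zc]]] := W1oo_cP (zeta k).
Qed.
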